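(* Let $d\in\{2,3,\dots\}$. There is a canonical one-one correspondence between the following three classes of objects. (A) States $\hat\omega$ on the Cuntz algebra $\mathcal{O}_d$. (B) Functions $C\colon\mathcal{I}\times\mathcal{I}\to\mathbb{C}$ such that: (i) $C(\varnothing,\varnothing)=1$; (ii) for every function $\lambda\colon\mathcal{I}\to\mathbb{C}$ with finite support, $\sum_{I,J\in\mathcal{I}}\overline{\lambda(I)}\,C(I,J)\,\lambda(J)\ge 0$; (iii) $\sum_{i\in\mathbb{Z}_d}C(Ii,Ji)=C(I,J)$ for all $I,J\in\mathcal{I}$. (C) Unitary equivalence classes of objects $(\mathcal{K},\Omega,V_1,\dots,V_d)$ where (i) $\mathcal{K}$ is a Hilbert space; (ii) $\Omega$ is a unit vector in $\mathcal{K}$; (iii) $V_1,\dots,V_d\in\mathcal{B}(\mathcal{K})$; (iv) the linear span of the vectors $V_I^*\Omega$, $I\in\mathcal{I}$, is dense in $\mathcal{K}$; (v) $\sum_{i\in\mathbb{Z}_d}V_iV_i^*=1_{\mathcal{K}}$. The correspondence is given by $$\hat\omega(s_Is_J^* )=C(I,J)=\langle V_I^*\Omega \mid V_J^*\Omega\rangle\qquad (I,J\in\mathcal{I}).$$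
   Context: $\mathcal{O}_d$ is the universal $C^*$-algebra generated by $s_1,\dots,s_d$ with $s_i^*s_j=\delta_{ij}1$ and $\sum_{j=1}^d s_js_j^*=1$. $\mathbb{Z}_d$ denotes an index set of $d$ elements (labelling the generators). $\mathcal{I}$ is the set of all finite sequences $(i_1,\dots,i_m)$, $m\ge 1$, with entries in $\mathbb{Z}_d$, together with the empty sequence $\varnothing$. For $I=(i_1,\dots,i_m)\in\mathcal{I}$ and $i\in\mathbb{Z}_d$, $Ii=(i_1,\dots,i_m,i)$; $s_I=s_{i_1}\cdots s_{i_m}$, $s_I^*=s_{i_m}^*\cdots s_{i_1}^*$, $s_\varnothing=s_\varnothing^*=1$; similarly $V_I=V_{i_1}\cdots V_{i_m}$, $V_I^*=V_{i_m}^*\cdots V_{i_1}^*$, $V_\varnothing=1$. Inner products are linear in the second variable. Two objects $(\mathcal{K},\Omega,V_1,\dots,V_d)$ and $(\mathcal{K}',\Omega',V_1',\dots,V_d')$ are unitarily equivalent if there is a unitary $\mathcal{K}\to\mathcal{K}'$ carrying $\Omega$ to $\Omega'$ and intertwining $V_i$ with $V_i'$ for all $i$. *)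

(* Defs.v *)
(* The field of complex numbers is R[i] for R : realType. *)
From HB Require Import structures.
From mathcomp Require Export all_boot all_order all_algebra.
From mathcomp Require Export complex.
From mathcomp Require Export all_classical all_reals.
From mathcomp Require Export topology normedtype.

Set Implicit Arguments.
Unset Strict Implicit.
Unset Printing Implicit Defensive.

Import Order.TTheory GRing.Theory Num.Theory.
Export numFieldNormedType.Exports.

Local Open Scope classical_set_scope.
Local Open Scope ring_scope.
Local Open Scope complex_scope.

(* Norms of complex normed modules take values in R[i], whose order satisfies
   x <= y iff y - x is real and nonnegative. *)

(* Inner products are linear in the second variable. *)
HB.mixin Record isHilbert (R : realType) V & CompleteNormedModule R[i] V := {
  inner : V -> V -> R[i];
  innerDr : forall x y z, inner x (y + z) = inner x y + inner x z;
  innerZr : forall (a : R[i]) x y, inner x (a *: y) = a * inner x y;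
  innerC : forall x y, inner x y = Num.conj (inner y x);
  innerxx : forall x, inner x x = `|x| ^+ 2;
}.

#[short(type="hilbertType")]
HB.structure Definition Hilbert (R : realType) :=
  {V of CompleteNormedModule R[i] V & isHilbert R V}.

(* Unital C*-algebras.  The ring operations are part of the mixin because
   Hierarchy Builder cannot join GRing.Algebra with CompleteNormedModule:
   rings and normed modules already meet at Num.NumDomain. *)
HB.mixin Record isCStarAlgebra (R : realType) A
    & CompleteNormedModule R[i] A := {
  cmul : A -> A -> A;
  cone : A;
  star : A -> A;
  cmulA : associative cmul;
  cmul1x : left_id cone cmul;
  cmulx1 : right_id cone cmul;
  cmulDl : left_distributive cmul +%R;
  cmulDr : right_distributive cmul +%R;
  cmulZl : forall (a : R[i]) x y, cmul (a *: x) y = a *: cmul x y;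
  cmulZr : forall (a : R[i]) x y, cmul x (a *: y) = a *: cmul x y;
  starD : forall x y, star (x + y) = star x + star y;
  starZ : forall (a : R[i]) x, star (a *: x) = Num.conj a *: star x;
  starM : forall x y, star (cmul x y) = cmul (star y) (star x);
  starK : involutive star;
  norm_cmul_le : forall x y, `|cmul x y| <= `|x| * `|y|;
  cstar_norm : forall x, `|cmul (star x) x| = `|x| ^+ 2;
}.

#[short(type="cstarAlgType")]
HB.structure Definition CStarAlgebra (R : realType) :=
  {A of CompleteNormedModule R[i] A & isCStarAlgebra R A}.

Arguments cone {R s}.

Section CuntzAlgebra.
Variables (R : realType) (d : nat).

Definition cuntz_relations (A : cstarAlgType R) (s : 'I_d -> A) : Prop :=
  (forall i j, cmul (star (s i)) (s j) = if i == j then cone else 0) /\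
  \sum_(j < d) cmul (s j) (star (s j)) = cone.

Definition closed_star_subalgebra (A : cstarAlgType R) (S : set A) : Prop :=
  [/\ closed S, S cone, forall (a : R[i]) x y, S x -> S y -> S (a *: x + y),
      forall x y, S x -> S y -> S (cmul x y) & forall x, S x -> S (star x)].

(* (A, s) is the universal C*-algebra O_d with its generators, characterized
   up to a unique isomorphism; uniqueness of f follows from cuntz_generated. *)
Record is_cuntz_algebra (A : cstarAlgType R) (s : 'I_d -> A) : Prop := {
  cuntz_rel : cuntz_relations s;
  cuntz_generated : forall S : set A,
    closed_star_subalgebra S -> (forall i, S (s i)) -> S = setT;
  cuntz_universal : forall (B : cstarAlgType R) (t : 'I_d -> B),
    cuntz_relations t ->
    exists f : {linear A -> B},
      [/\ f cone = cone, forall x y, f (cmul x y) = cmul (f x) (f y),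
          forall x, f (star x) = star (f x) & forall i, f (s i) = t i];
}.

Definition is_state (A : cstarAlgType R) (w : A -> R[i]) : Prop :=
  [/\ scalar w, forall x, 0 <= w (cmul (star x) x) & w cone = 1].

Definition state (A : cstarAlgType R) := {w : A -> R[i] | is_state w}.

Definition word_prod (A : cstarAlgType R) (s : 'I_d -> A) (I : seq 'I_d) : A :=
  \big[cmul/cone]_(i <- I) s i.

Definition is_cuntz_kernel (C : seq 'I_d -> seq 'I_d -> R[i]) : Prop :=
  [/\ C [::] [::] = 1,
      forall l : seq 'I_d -> R[i], finite_set [set I | l I != 0] ->
        0 <= \sum_(I \in [set: seq 'I_d]) \sum_(J \in [set: seq 'I_d])
               Num.conj (l I) * C I J * l J
    & forall I J, \sum_(i < d) C (rcons I i) (rcons J i) = C I J].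

Definition cuntz_kernel :=
  {C : seq 'I_d -> seq 'I_d -> R[i] | is_cuntz_kernel C}.

(* The vector z with <T x | y> = <x | z> for all x; for bounded T it exists
   and is unique by Riesz representation. *)
Definition adjoint (K : hilbertType R) (T : K -> K) (y : K) : K :=
  xget 0 [set z | forall x, inner (T x) y = inner x z].

(* V_I^* = V_{i_m}^* ... V_{i_1}^*, so V_{i_1}^* is applied first *)
Definition word_adjoint (K : hilbertType R) (V : 'I_d -> K -> K)
    (I : seq 'I_d) (x : K) : K :=
  foldl (fun y i => adjoint (V i) y) x I.

Record cuntz_object := CuntzObject {
  space : hilbertType R;
  vac : space;
  ops : 'I_d -> {linear space -> space};
  vac_unit : `|vac| = 1;
  ops_bounded : forall i, bounded_near (ops i) (nbhs (0 : space));
  vac_cyclic : dense [set x : space | exists l : seq 'I_d -> R[i],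
    finite_set [set I | l I != 0] /\
    x = \sum_(I \in [set: seq 'I_d]) l I *: word_adjoint ops I vac];
  ops_sum : forall x, \sum_(i < d) ops i (adjoint (ops i) x) = x;
}.

Definition unitary_equivalent (X Y : cuntz_object) : Prop :=
  exists U : {linear space X -> space Y},
    [/\ bijective U, forall x y, inner (U x) (U y) = inner x y,
        U (vac X) = vac Y & forall i x, U (ops X i x) = ops Y i (U x)].

(* Equivalence classes are predicates, since cuntz_object is too large a type
   for [set cuntz_object]. *)
Definition unitary_class :=
  {P : cuntz_object -> Prop | exists X, P = unitary_equivalent X}.

Definition class_of (X : cuntz_object) : unitary_class :=
  exist _ (unitary_equivalent X) (ex_intro _ X erefl).

End CuntzAlgebra.

Arguments cuntz_kernel R d : clear implicits.
Arguments cuntz_object R d : clear implicits.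
Arguments unitary_class R d : clear implicits.

(* Main.v *)
(** A kernel C is the Gram kernel of vectors v_I in a Hilbert space K, and the
   relation sum_i C(Ii, Ji) = C(I, J) says exactly that the maps
   T_i : v_I |-> v_(Ii) extend to contractions with sum_i T_i^* T_i = 1; then
   V_i = T_i^* gives an object with V_I^* Omega = v_I, and two objects with the
   same kernel are identified by the isometry matching these vectors.
   A state on O_d is bounded, hence determined by its values on the monomials
   s_I s_J^*, whose span is dense.  Conversely, writing every word on the left
   of a monomial with a common length n shows that C determines a positive
   semidefinite kernel on pairs (I, J), namely what the inner product of
   s_I s_J^* Omega and s_K s_L^* Omega has to be.  Its Hilbert space carries
   the shifts (I, J) |-> (iI, J), which satisfy the Cuntz relations in B(H);
   the universal property of O_d then turns the vector (empty, empty) into the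
   required state. *)
From HB Require Import structures.
Require Import Defs.
From mathcomp Require Import interval_inference finmap ring lra.

Set Implicit Arguments.
Unset Strict Implicit.
Unset Printing Implicit Defensive.
Import Order.TTheory GRing.Theory Num.Theory.
Local Open Scope classical_set_scope.
Local Open Scope ring_scope.
Local Open Scope complex_scope.
Import Normc.

(** * The modulus of a complex number *)

(** The monomials s_I s_J^* are linearly dependent, since each equals the sum over i of the
    monomials with words Ii and Ji. Prescribing a functional on them would therefore need a proof of
    consistency as well as of positivity. Passing to a Hilbert space settles both: dependent
    combinations become vectors at distance zero, and the universal property supplies a functional
    on the whole algebra. That property quantifies over C*-algebras, so B(H) has to be constructed
    as one. A single space of bounded semilinear maps serves for this and for completing a form: the
    completion consists of bounded antilinear functionals, null vectors become the zero functional,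
    no quotient is formed, and completeness is inherited from the complex numbers. Limits are always
    taken at the explicit rate 1/(n+1), which turns equalities into estimates by a multiple of
    [eps R n]. *)

Section Complex.
Variable R : realType.
Implicit Types z w : R[i].

Lemma normc_ge0 z : 0 <= normc z.
Proof. by case: z => a b; rewrite sqrtr_ge0. Qed.

Lemma normc_real (x : R) : normc x%:C = `|x|.
Proof. by rewrite /= expr0n addr0 sqrtr_sqr. Qed.

Lemma normcJ z : normc (Num.conj z) = normc z.
Proof. by case: z => a b /=; rewrite sqrrN. Qed.

Lemma conj_real (x : R) : Num.conj (x%:C : R[i]) = x%:C.
Proof. exact: conjc_real. Qed.

Lemma normc_Re z : `|complex.Re z| <= normc z.
Proof.
case: z => a b /=; rewrite -sqrtr_sqr ler_wsqrtr// lerDl; exact: sqr_ge0.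
Qed.

Lemma normc_Im z : `|complex.Im z| <= normc z.
Proof.
case: z => a b /=; rewrite -sqrtr_sqr ler_wsqrtr// lerDr; exact: sqr_ge0.
Qed.

Lemma normc_le z : normc z <= `|complex.Re z| + `|complex.Im z|.
Proof.
rewrite -[leRHS]ger0_norm ?addr_ge0// -sqrtr_sqr.
case: z => a b /=; rewrite ler_wsqrtr// sqrrD !real_normK ?num_real//.
by rewrite lerD2r lerDl mulrn_wge0// mulr_ge0.
Qed.

Lemma normc_sqr z : z * Num.conj z = (normc z ^+ 2)%:C.
Proof. by rewrite -normCK rmorphXn. Qed.

Lemma ge0_complexE z : 0 <= z -> z = (complex.Re z)%:C.
Proof. by move=> z0; rewrite RRe_real// ger0_real. Qed.

Lemma gt0_Re z : 0 < z -> 0 < complex.Re z.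
Proof. by case: z => a b; rewrite ltcE => /andP[]. Qed.

Lemma ReM_real (a : R) z : complex.Re (a%:C * z) = a * complex.Re z.
Proof. by case: z => x y /=; rewrite mul0r subr0. Qed.

Lemma ReD z w : complex.Re (z + w) = complex.Re z + complex.Re w.
Proof. by case: z; case: w. Qed.

Lemma ReN z : complex.Re (- z) = - complex.Re z.
Proof. by case: z. Qed.

Lemma ReJ z : complex.Re (Num.conj z) = complex.Re z.
Proof. by case: z. Qed.

Lemma normc_tri z (x y : R[i]) : normc (x - y) <= normc (x - z) + normc (z - y).
Proof. by rewrite (le_trans _ (le_normcD _ _))// addrA subrK. Qed.

Lemma normc_dist z w : normc (z - w) = normc (w - z).
Proof. by rewrite -normcN opprB. Qed.

End Complex.

(** * Real-valued norms and limits *)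

Section RealNorm.
Variables (R : realType) (V : normedModType R[i]).
Implicit Types x y : V.

(** Norms here are complex numbers; their real parts carry the same information and live in an
    ordered field where linear arithmetic applies. *)
Definition nm x : R := complex.Re `|x|.

Lemma nmE x : `|x| = (nm x)%:C.
Proof. by rewrite /nm RRe_real// normr_real. Qed.

Lemma nm_ge0 x : 0 <= nm x.
Proof. by rewrite -lecR -nmE normr_ge0. Qed.

Lemma nmD x y : nm (x + y) <= nm x + nm y.
Proof. by have := ler_normD x y; rewrite !nmE -rmorphD lecR. Qed.

Lemma nmN x : nm (- x) = nm x.
Proof. by rewrite /nm normrN. Qed.

Lemma nmB x y : nm (x - y) <= nm x + nm y.
Proof. by rewrite -(nmN y) nmD. Qed.

Lemma nm_dist x y : nm (x - y) = nm (y - x).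
Proof. by rewrite /nm distrC. Qed.

Lemma nm_tri z x y : nm (x - y) <= nm (x - z) + nm (z - y).
Proof. by rewrite (le_trans _ (nmD _ _))// addrA subrK. Qed.

Lemma nmZ (a : R[i]) x : nm (a *: x) = normc a * nm x.
Proof.
by have := normrZ a x; rewrite !nmE -rmorphM => /complexI.
Qed.

Lemma nm0 : nm (0 : V) = 0. Proof. by rewrite /nm normr0. Qed.

Lemma nm_eq0 x : nm x <= 0 -> x = 0.
Proof.
move=> x0; apply/normr0_eq0; rewrite nmE.
by have -> : nm x = 0 by apply/le_anti; rewrite x0 nm_ge0.
Qed.

Lemma closed_nm (S : set V) : closed S <->
  forall x, (forall e : R, 0 < e -> exists2 y, S y & nm (x - y) < e) -> S x.
Proof.
split=> [cS x xS|xS].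
  apply: cS => B /nbhs_normP[_/posnumP[e] eB].
  have eE : e%:num = (complex.Re e%:num)%:C by rewrite -ge0_complexE.
  have e0 : 0 < complex.Re e%:num by rewrite gt0_Re.
  have [y Sy xy] := xS _ e0.
  by exists y; split=> //; apply: eB => /=; rewrite nmE eE ltcR.
move=> x Sx; apply: xS => e e0.
have e0' : 0 < e%:C by rewrite ltcR.
have [y [Sy xy]] := Sx _ (nbhsx_ballx x _ e0').
exists y => //.
by move: xy; rewrite -ball_normE /= nmE ltcR.
Qed.

Lemma dense_nm (S : set V) : dense S <->
  forall x (e : R), 0 < e -> exists2 y, S y & nm (x - y) < e.
Proof.
split=> [dS x e e0|dS].
  have e0' : 0 < e%:C by rewrite ltcR.
  have [y [xy Sy]] : (ball x e%:C `&` S) !=set0.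
    by apply: dS; [exists x; apply: ballxx | apply: ball_open].
  by exists y => //; move: xy; rewrite -ball_normE /= nmE ltcR.
move=> O [x Ox] oO.
have /nbhs_normP[_/posnumP[e] eO] := open_nbhs_nbhs (conj oO Ox).
have eE : e%:num = (complex.Re e%:num)%:C by rewrite -ge0_complexE.
have e0 : 0 < complex.Re e%:num by rewrite gt0_Re.
have [y Sy xy] := dS x _ e0.
by exists y; split=> //; apply: eO => /=; rewrite nmE eE ltcR.
Qed.

End RealNorm.

Section RealBounded.
Variables (R : realType) (V W : normedModType R[i]).

Lemma bounded_nm (f : {linear V -> W}) :
  bounded_near f (nbhs (0 : V)) <-> exists c, forall x, nm (f x) <= c * nm x.
Proof.
rewrite linear_boundedP; split=> [/pinfty_ex_gt0[c c0 fc]|[c fc]].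
  exists (complex.Re c) => x; have := fc x.
  by rewrite !nmE (ge0_complexE (ltW c0)) -rmorphM lecR.
exists c%:C; split; first by rewrite complex_real.
move=> b cb x; rewrite (le_trans _ (ler_wpM2r (normr_ge0 x) (ltW cb)))//.
by rewrite !nmE -rmorphM lecR.
Qed.

End RealBounded.

(** * Approximation at the rate 1/(n+1) *)

Section Epsilon.
Variable R : realType.

Definition eps (n : nat) : R := n.+1%:R^-1.

Lemma eps_gt0 n : 0 < eps n. Proof. by rewrite invr_gt0. Qed.

Lemma eps_ge0 n : 0 <= eps n. Proof. exact/ltW/eps_gt0. Qed.

Lemma eps_le1 n : eps n <= 1.
Proof. by rewrite invf_le1// ler1n. Qed.

Lemma eps_small (e : R) : 0 < e -> exists n, eps n < e.
Proof.
move=> e0; exists (Num.truncn e^-1); rewrite -[ltRHS]invrK ltf_pV2 ?posrE ?invr_gt0//.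
exact: truncnS_gt.
Qed.

Lemma le_eps (a b c : R) : (forall n, a <= b + c * eps n) -> a <= b.
Proof.
move=> h; rewrite leNgt; apply/negP => ba.
have [c0|c0] := leP c 0.
  have := h 0; have := eps_gt0 0; nra.
have [|n hn] := @eps_small ((a - b) / c); first by rewrite divr_gt0// subr_gt0.
by have := h n; move: hn; rewrite ltr_pdivlMr//; lra.
Qed.

Lemma le_eps0 (a c : R) : (forall n, a <= c * eps n) -> a <= 0.
Proof. by move=> h; apply: (@le_eps _ _ c) => n; rewrite add0r. Qed.

(** The limit is the supremum of the lower estimates [u n - c * eps n], each of which lies below
    every upper estimate [u m + c * eps m]. *)
Lemma fast_cvgR (u : nat -> R) c :
  (forall n m, `|u n - u m| <= c * (eps n + eps m)) ->
  exists l, forall n, `|u n - l| <= c * eps n.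
Proof.
move=> h; pose S := [set x | exists n, x = u n - c * eps n].
have ub m : ubound S (u m + c * eps m).
  move=> _ [n ->]; have := h n m; rewrite ler_norml => /andP[_]; lra.
have hS : has_sup S.
  by split; [exists (u 0 - c * eps 0), 0|exists (u 0 + c * eps 0); apply: ub].
exists (sup S) => n; rewrite ler_norml.
have := ge_sup hS.1 (ub n).
have : u n - c * eps n <= sup S by apply: sup_upper_bound => //; exists n.
lra.
Qed.

Lemma eps_exp n : (2^-1 : R) ^+ n <= eps n.
Proof.
rewrite exprVn lef_pV2 ?posrE ?exprn_gt0// -natrX ler_nat.
by rewrite -[X in (_ <= X)%N]/(2 ^ n)%N ltn_expl.
Qed.

End Epsilon.

Section FastLimits.
Variable R : realType.

Lemma eq_nm_eps (V : normedModType R[i]) (x y : V) (c : R) :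
  (forall n, nm (x - y) <= c * eps R n) -> x = y.
Proof. by move=> h; apply/eqP; rewrite -subr_eq0; apply/eqP/nm_eq0/(le_eps0 h). Qed.

Lemma eq_normc_eps (x y : R[i]) (c : R) :
  (forall n, normc (x - y) <= c * eps R n) -> x = y.
Proof.
move=> h; apply/eqP; rewrite -subr_eq0; apply/eqP/eq0_normc/le_anti.
by rewrite normc_ge0 (le_eps0 h).
Qed.

Lemma fast_cvg (V : completeNormedModType R[i]) (u : nat -> V) (c : R) :
  (forall n m, nm (u n - u m) <= c * (eps R n + eps R m)) ->
  exists l, forall n, nm (u n - l) <= c * eps R n.
Proof.
move=> h.
have c0 : 0 <= c.
  have := le_trans (nm_ge0 _) (h 0 0); have := eps_gt0 R 0; nra.
have lim_eps n : \forall m \near \oo, nm (u n - u m) <= c * eps R n + c * eps R n.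
  exists n => // m /= nm'; apply: le_trans (h _ _) _.
  by rewrite mulrDr lerD2l ler_wpM2l// lef_pV2 ?posrE// ler_nat ltnS.
have uc : cauchy (u @ \oo).
  apply/cauchy_exP => e e0; have eE := ge0_complexE (ltW e0).
  have e0' := gt0_Re e0.
  have [|n hn] := @eps_small R (complex.Re e / (2 * (c + 1))).
    by rewrite divr_gt0//; nra.
  exists (u n); have := lim_eps n; apply: filterS => m /= hm.
  rewrite -ball_normE /= nmE eE ltcR; apply: le_lt_trans hm _.
  move: hn; rewrite ltr_pdivlMr; last by nra.
  have := eps_gt0 R n; nra.
have /cvg_ex[l /= ul] : cvg (u @ \oo) by apply: cauchy_cvg.
exists l => n; apply: (@le_eps _ _ _ (c + 1)) => m.
have e0 : 0 < (eps R m)%:C by rewrite ltcR eps_gt0.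
have /cvgr_dist_lt/(_ _ e0) := ul.
have mm : \forall k \near \oo, (m <= k)%N by exists m.
move=> /(filterI mm)/filter_ex[k [/= mk]].
rewrite nmE ltcR => lk.
apply: le_trans (nm_tri (u k) _ _) _.
apply: le_trans (lerD (h n k) (ltW _)) _; first by rewrite nm_dist; exact: lk.
rewrite mulrDr -addrA lerD2l mulrDl mul1r lerD2r ler_wpM2l//.
by rewrite lef_pV2 ?posrE// ler_nat ltnS.
Qed.

(** Reduces completeness for filters to sequences with a rate: a Cauchy filter contains a ball of
    radius [eps R n] for every n, and any two of these balls meet, so their centres form such a
    sequence. *)
Lemma fast_complete (V : normedModType R[i]) :
  (forall u : nat -> V, (forall n m, nm (u n - u m) <= 1 * (eps R n + eps R m)) ->
    exists l, forall n, nm (u n - l) <= 1 * eps R n) ->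
  forall F : set_system V, ProperFilter F -> cauchy F -> cvg F.
Proof.
move=> h F FF /cauchyP Fc.
have e0 n : 0 < (eps R n)%:C by rewrite ltcR eps_gt0.
have /choice[u uP] n : exists x, F (ball x (eps R n)%:C) by apply: Fc.
have [n m|l ul] := h u.
  have [y [/=]] := filter_ex (filterI (uP n) (uP m)).
  rewrite -!ball_normE/= !nmE !ltcR mul1r => hn hm.
  by rewrite (le_trans (nm_tri y _ _))// lerD// ltW// nm_dist.
apply/cvg_ex; exists l; apply/cvgrPdist_lt => e e1; have eE := ge0_complexE (ltW e1).
have e1' := gt0_Re e1.
have [|n hn] := @eps_small R (complex.Re e / 2); first by rewrite divr_gt0.
have := uP n; apply: filterS => y; rewrite -ball_normE/= nmE ltcR => hy.
rewrite nmE eE ltcR (le_lt_trans (nm_tri (u n) _ _))//.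
by have := ul n; rewrite nm_dist mul1r; lra.
Qed.

(* Completeness cannot be declared on R[i]^o itself: the completeness instance
   of realType already occupies the canonical projection of _^o. *)
Definition cpx : Type := R[i]^o.
HB.instance Definition _ := NormedModule.copy cpx R[i]^o.

Lemma cpx_fast_cvg (u : nat -> cpx) (c : R) :
  (forall n m, nm (u n - u m) <= c * (eps R n + eps R m)) ->
  exists l, forall n, nm (u n - l) <= c * eps R n.
Proof.
move=> h.
have [n m|a ha] := @fast_cvgR R (@complex.Re R \o u) c.
  apply: le_trans (h n m) => /=; apply: le_trans (normc_Re _).
  by rewrite ReD ReN.
have [n m|b hb] := @fast_cvgR R (@complex.Im R \o u) c.
  apply: le_trans (h n m) => /=; apply: le_trans (normc_Im _).
  by case: (u n); case: (u m).
(* Of the error [3 * c * eps R m], one third comes from [u n - u m] and one third from each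
   coordinate of [u m - l]. *)
exists (a +i* b) => n; apply: (@le_eps _ _ _ (3 * c)) => m.
apply: le_trans (nm_tri (u m) _ _) _; apply: le_trans (lerD (h n m) (normc_le _)) _.
have := ha m; have := hb m; rewrite /=; case: (u m) => x y /=; lra.
Qed.

HB.instance Definition _ :=
  Uniform_isComplete.Build cpx (fast_complete (@cpx_fast_cvg ^~ 1)).

End FastLimits.

(** * Bounded semilinear maps *)

Section BoundedOperators.
Variables (R : realType) (sigma : R[i] -> R[i]) (V : lmodType R[i]) (p : V -> R)
  (W : completeNormedModType R[i]).

(** Used twice: conjugation with the seminorm of a form gives the completion of that form, and the
    identity with the norm gives B(H). The absolute value of [p x] allows any real function [p] and
    lets [M] be replaced by its absolute value. *)
Definition is_bop (f : V -> W) : Prop :=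
  (forall a x y, f (a *: x + y) = sigma a *: f x + f y) /\
  exists M, forall x, nm (f x) <= M * `|p x|.

Definition bop_pred : {pred V -> W} := fun f => `[< is_bop f >].

Record bop := Bop { bop_fun :> V -> W; bop_funP : bop_fun \in bop_pred }.

HB.instance Definition _ := [isSub for bop_fun].
HB.instance Definition _ := [Choice of bop by <:].

Lemma bop_submod_closed : submod_closed bop_pred.
Proof.
split=> [|a f g /asboolP[fl [M fM]] /asboolP[gl [N gN]]]; apply/asboolP; split.
- by move=> a x y; rewrite /= scaler0 addr0.
- by exists 0 => x /=; rewrite mul0r nm0.
- move=> b x y; rewrite !fctE fl gl !scalerDr !scalerA mulrC -!addrA; congr +%R.
  by rewrite addrCA.
- exists (normc a * M + N) => x; rewrite !fctE (le_trans (nmD _ _))// nmZ mulrDl.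
  by rewrite lerD// -mulrA ler_wpM2l ?normc_ge0.
Qed.

HB.instance Definition _ :=
  GRing.isSubmodClosed.Build R[i] (V -> W) bop_pred bop_submod_closed.
HB.instance Definition _ := [SubChoice_isSubLmodule of bop by <:].

Implicit Types f g : bop.

Lemma bopP f : is_bop f. Proof. exact/asboolP/bop_funP. Qed.

Lemma bopDE f g x : (f + g) x = f x + g x. Proof. by []. Qed.
Lemma bopNE f x : (- f) x = - f x. Proof. by []. Qed.
Lemma bopZE a f x : (a *: f) x = a *: f x. Proof. by []. Qed.

Lemma bop_eq f g : f =1 g -> f = g.
Proof. by move=> fg; apply/val_inj/funext. Qed.

Definition bop_norm f : R :=
  inf [set M | 0 <= M /\ forall x, nm (f x) <= M * `|p x|].

Lemma bop_bounds f :
  has_inf [set M | 0 <= M /\ forall x, nm (f x) <= M * `|p x|].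
Proof.
split; last by exists 0 => M [].
have [_ [M hM]] := bopP f; exists `|M|; split=> // x.
by rewrite (le_trans (hM x))// ler_wpM2r// ler_norm.
Qed.

Lemma bop_norm_ge0 f : 0 <= bop_norm f.
Proof. by apply: lb_le_inf => [|M []//]; exact: (bop_bounds f).1. Qed.

Lemma bop_normP f x : nm (f x) <= bop_norm f * `|p x|.
Proof.
have [p0|p0] := eqVneq (p x) 0.
  by have [_ [M /(_ x)]] := bopP f; rewrite p0 normr0 !mulr0.
rewrite -ler_pdivrMr ?normr_gt0//; apply: lb_le_inf; first exact: (bop_bounds f).1.
by move=> M [_ hM]; rewrite ler_pdivrMr ?normr_gt0.
Qed.

Lemma bop_norm_le f M :
  0 <= M -> (forall x, nm (f x) <= M * `|p x|) -> bop_norm f <= M.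
Proof. by move=> M0 hM; apply: inf_lbound => //; exact: (bop_bounds f).2. Qed.

Lemma bop_normD f g : bop_norm (f + g) <= bop_norm f + bop_norm g.
Proof.
apply: bop_norm_le => [|x]; first by rewrite addr_ge0 ?bop_norm_ge0.
by rewrite bopDE (le_trans (nmD _ _))// mulrDl lerD// bop_normP.
Qed.

Lemma bop_normZ_le a f : bop_norm (a *: f) <= normc a * bop_norm f.
Proof.
apply: bop_norm_le => [|x]; first by rewrite mulr_ge0 ?normc_ge0 ?bop_norm_ge0.
by rewrite bopZE nmZ -mulrA ler_wpM2l ?normc_ge0// bop_normP.
Qed.

Lemma bop_normZ a f : bop_norm (a *: f) = normc a * bop_norm f.
Proof.
apply/le_anti; rewrite bop_normZ_le/=.
have [->|a0] := eqVneq a 0; first by rewrite normc0 mul0r bop_norm_ge0.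
have a1 : 0 < normc a.
  rewrite lt_neqAle normc_ge0 andbT eq_sym.
  by apply: contra a0 => /eqP/eq0_normc ->.
rewrite -ler_pdivlMl// -normcV (le_trans _ (bop_normZ_le _ _))//.
by rewrite scalerA mulVf// scale1r.
Qed.

Lemma bop_normCD f g : (bop_norm (f + g))%:C <= (bop_norm f)%:C + (bop_norm g)%:C.
Proof. by rewrite -rmorphD lecR bop_normD. Qed.

Lemma bop_normCZ a f : (bop_norm (a *: f))%:C = `|a| * (bop_norm f)%:C.
Proof. by rewrite bop_normZ rmorphM. Qed.

Lemma bop_normC0 f : (bop_norm f)%:C = 0 -> f = 0.
Proof.
move=> /complexI f0; apply: bop_eq => x; apply: nm_eq0.
by rewrite (le_trans (bop_normP f x))// f0 mul0r.
Qed.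

HB.instance Definition _ :=
  Lmodule_isNormed.Build R[i] bop bop_normCD bop_normCZ bop_normC0.

Lemma bop_nm f : nm f = bop_norm f. Proof. by []. Qed.

(** The pointwise limits are reached at the rate [|p x| * eps R n]. This is proportional to [|p x|],
    so the limit is again bounded and the convergence holds in norm. *)
Lemma bop_fast_cvg (u : nat -> bop) :
  (forall n m, nm (u n - u m) <= 1 * (eps R n + eps R m)) ->
  exists l, forall n, nm (u n - l) <= 1 * eps R n.
Proof.
move=> h.
have /choice[f fP] x : exists y, forall n, nm (u n x - y) <= `|p x| * eps R n.
  apply: fast_cvg => n m; rewrite mulrC (le_trans (bop_normP (u n - u m) x))//.
  by rewrite ler_wpM2r// -bop_nm (le_trans (h n m))// mul1r.
have fl a x y : f (a *: x + y) = sigma a *: f x + f y.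
  apply/eqP; rewrite -subr_eq0; apply/eqP/nm_eq0.
  apply: (@le_eps0 _ _ (`|p (a *: x + y)| + normc (sigma a) * `|p x| + `|p y|)) => n.
  have -> : f (a *: x + y) - (sigma a *: f x + f y) =
    - (u n (a *: x + y) - f (a *: x + y)) + sigma a *: (u n x - f x) + (u n y - f y).
    rewrite (bopP (u n)).1 scalerBr.
    by rewrite opprB -addrA [X in _ = _ + X]addrACA -opprD addrA subrK.
  rewrite !mulrDl (le_trans (nmD _ _))// lerD ?fP// (le_trans (nmD _ _))//.
  by rewrite nmN nmZ lerD ?fP// -mulrA ler_wpM2l ?normc_ge0.
have fb : f \in bop_pred.
  apply/asboolP; split=> //; exists (bop_norm (u 0) + 1) => x.
  rewrite -[f x](subKr (u 0 x)) (le_trans (nmB _ _))// mulrDl lerD ?bop_normP//.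
  by rewrite (le_trans (fP x 0))// mulrC ler_wpM2r// eps_le1.
exists (Bop fb) => n; rewrite bop_nm mul1r; apply: bop_norm_le; first exact: eps_ge0.
by move=> x; rewrite bopDE bopNE/= (le_trans (fP x n))// mulrC.
Qed.

HB.instance Definition _ := Uniform_isComplete.Build bop (fast_complete bop_fast_cvg).

End BoundedOperators.

(** * Positive semidefinite forms *)

Section Forms.
Variables (R : realType) (V : lmodType R[i]).

Record psd_form (B : V -> V -> R[i]) : Prop := PsdForm {
  formDl : forall x y z, B (x + y) z = B x z + B y z;
  formZl : forall a x y, B (a *: x) y = Num.conj a * B x y;
  formDr : forall x y z, B x (y + z) = B x y + B x z;
  formZr : forall a x y, B x (a *: y) = a * B x y;
  form_ge0 : forall x, 0 <= B x x }.

Definition sn (B : V -> V -> R[i]) (x : V) : R := Num.sqrt (complex.Re (B x x)).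

Variables (B : V -> V -> R[i]) (hB : psd_form B).

Lemma form_Re_ge0 x : 0 <= complex.Re (B x x).
Proof. by rewrite -lecR -ge0_complexE form_ge0. Qed.

Lemma sn_ge0 x : 0 <= sn B x. Proof. exact: sqrtr_ge0. Qed.

Lemma sn_sqr x : sn B x ^+ 2 = complex.Re (B x x).
Proof. by rewrite sqr_sqrtr// form_Re_ge0. Qed.

Lemma form_snE x : B x x = (sn B x ^+ 2)%:C.
Proof. by rewrite sn_sqr -ge0_complexE// form_ge0. Qed.

Lemma formNl x y : B (- x) y = - B x y.
Proof. by rewrite -scaleN1r formZl// rmorphN rmorph1 mulN1r. Qed.

Lemma formNr x y : B x (- y) = - B x y.
Proof. by rewrite -scaleN1r formZr// mulN1r. Qed.

Lemma formBl x y z : B (x - y) z = B x z - B y z.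
Proof. by rewrite formDl// formNl. Qed.

Lemma formBr x y z : B x (y - z) = B x y - B x z.
Proof. by rewrite formDr// formNr. Qed.

(** Polarization: positivity makes the values of the form at x + y and x + iy real, which gives the
    imaginary and the real part of the identity. *)
Lemma form_herm x y : B x y = Num.conj (B y x).
Proof.
have h1 := form_ge0 hB (x + y); have h2 := form_ge0 hB (x + 'i%C *: y).
move: h1 h2 (form_snE x) (form_snE y).
rewrite !(formDl hB) !(formDr hB) !(formZl hB) !(formZr hB).
case: (B x x) => xx xx'; case: (B x y) => xy xy'; case: (B y x) => yx yx'.
case: (B y y) => yy yy' /ger0_Im /= h1 /ger0_Im /= h2 [_ e1] [_ e2].
by apply/eqP; rewrite eq_complex /=; apply/andP; split; apply/eqP; lra.
Qed.

(* Both the Cauchy-Schwarz inequality and the Riesz representation follow: the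
   hypothesis says that a quadratic functional is bounded below at its
   (approximate) minimum, and the bound comes from optimizing over multiples of u. *)
Lemma form_bound (L : V -> R[i]) (d : R) :
  (forall a u, L (a *: u) = a * L u) ->
  (forall u, 0 <= d + 2 * complex.Re (L u) + complex.Re (B u u)) ->
  forall u, normc (L u) ^+ 2 <= d * complex.Re (B u u).
Proof.
move=> LZ h u.
have b0 : 0 <= normc (L u) ^+ 2 by rewrite sqr_ge0.
have hs (s : R) : 0 <= d - 2 * s * normc (L u) ^+ 2
    + s ^+ 2 * normc (L u) ^+ 2 * complex.Re (B u u).
  have := h ((- s%:C * Num.conj (L u)) *: u).
  have sJ : Num.conj (- s%:C * Num.conj (L u)) = - s%:C * L u.
    by rewrite rmorphM rmorphN/= conjCK conj_real.
  rewrite LZ formZl// formZr// sJ.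
  have -> : - s%:C * Num.conj (L u) * L u = (- (s * normc (L u) ^+ 2))%:C.
    by rewrite rmorphN rmorphM/= -normc_sqr; ring.
  have -> : - s%:C * L u * (- s%:C * Num.conj (L u) * B u u) =
     (s ^+ 2 * normc (L u) ^+ 2)%:C * B u u.
    by rewrite [in RHS]rmorphM/= -normc_sqr [in RHS]rmorphXn /=; ring.
  by rewrite ReM_real /=; lra.
have c0 := form_Re_ge0 u.
move: (normc (L u) ^+ 2) (complex.Re (B u u)) b0 c0 hs => b c b0 c0 hs.
(* If [c = 0], the bound in [hs] is affine in s, and b > 0 is refuted by a value of s that makes it
   equal to -1. Otherwise the minimum is at s = 1/c. *)
have [c1|c1] := eqVneq c 0.
  rewrite c1 mulr0; rewrite leNgt; apply/negP => b1.
  have d0 := hs 0; have := hs ((d + 1) / (2 * b)).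
  have -> : 2 * ((d + 1) / (2 * b)) * b = d + 1 by field; lra.
  rewrite c1; lra.
have {}c0 : 0 < c by rewrite lt_neqAle eq_sym c1.
have := hs c^-1; rewrite -ler_pdivrMr//.
have -> : c^-1 ^+ 2 * b * c = b / c by field; lra.
by rewrite -mulrA (mulrC c^-1); lra.
Qed.

Lemma form_CS x y : normc (B x y) <= sn B x * sn B y.
Proof.
rewrite -[leLHS](ger0_norm (normc_ge0 _)) -[leRHS]ger0_norm ?mulr_ge0 ?sn_ge0//.
rewrite -ler_sqr ?nnegrE ?mulr_ge0 ?sn_ge0// !real_normK ?num_real// exprMn !sn_sqr.
apply: (@form_bound (B x)) => [a u|u]; first by rewrite formZr.
have := form_Re_ge0 (x + u); rewrite !(formDl hB) !(formDr hB) (form_herm u x).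
rewrite !ReD ReJ; lra.
Qed.

Lemma sn_le x c : 0 <= c -> normc (B x x) <= c * sn B x -> sn B x <= c.
Proof.
move=> c0; rewrite form_snE normc_real ger0_norm ?sqr_ge0// expr2.
have := sn_ge0 x; rewrite le_eqVlt => /predU1P[<-//|x0].
by rewrite ler_pM2r.
Qed.

(* [x] nearly minimizes [B x x - 2 Re (phi x)]. *)
Lemma riesz_approx (phi : V -> R[i]) (M : R) :
  (forall a x y, phi (a *: x + y) = a * phi x + phi y) ->
  (forall x, normc (phi x) <= M * sn B x) ->
  forall e, 0 < e -> exists x, forall u, normc (B x u - phi u) <= e * sn B u.
Proof.
move=> phil phiM e e0.
have phi0 : phi 0 = 0.
  have := phil 1 0 0; rewrite scaler0 addr0 mul1r => /esym/eqP.
  by rewrite -subr_eq0 addrK => /eqP.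
have phiD x y : phi (x + y) = phi x + phi y.
  by have := phil 1 x y; rewrite scale1r mul1r.
have phiZ a x : phi (a *: x) = a * phi x.
  by have := phil a x 0; rewrite phi0 !addr0.
pose J x := complex.Re (B x x) - 2 * complex.Re (phi x).
(* By completing the square: J x is at least t^2 - 2 M t, where t is the seminorm of x. *)
have Jlb x : - M ^+ 2 <= J x.
  rewrite /J -sn_sqr; have := phiM x; have := normc_Re (phi x).
  have := ler_norm (complex.Re (phi x)); have := sqr_ge0 (sn B x - M); nra.
have hJ : has_inf [set J x | x in [set: V]].
  split; first by exists (J 0), 0.
  by exists (- M ^+ 2) => _ [x _ <-].
(* The slack is [e ^+ 2] because [form_bound] estimates the square of the functional. *)
have e2 : 0 < e ^+ 2 by rewrite exprn_gt0.
have [_ [x _ <-] Jx] := inf_adherent e2 hJ.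
exists x => u.
rewrite -[leLHS](ger0_norm (normc_ge0 _)) -[leRHS]ger0_norm; last first.
  by rewrite mulr_ge0 ?sn_ge0// ltW.
have es : 0 <= e * sn B u by rewrite mulr_ge0 ?sn_ge0// ltW.
rewrite -ler_sqr ?nnegrE// !real_normK ?num_real// exprMn sn_sqr.
apply: (@form_bound (fun u => B x u - phi u)) => [a v|v].
  by rewrite formZr// phiZ mulrBr.
have : inf [set J x | x in [set: V]] <= J (x + v).
  by apply: inf_lbound; [exact: hJ.2|exists (x + v)].
move: Jx; rewrite /J !(formDl hB) !(formDr hB) (form_herm v x) phiD !ReD ReN ReJ.
lra.
Qed.

End Forms.

(** * Completion of a form to a Hilbert space *)

Definition dense_range (R : realType) (V : Type) (H : normedModType R[i])
  (j : V -> H) := forall x n, exists v, nm (x - j v) <= eps R n.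

Section Completion.
Variables (R : realType) (V : lmodType R[i]) (B : V -> V -> R[i])
  (hB : psd_form B).

(* The antilinear functionals on V bounded by the seminorm of B: the vector v
   is represented by u |-> B u v. *)
Definition completion of psd_form B : Type := bop (@Num.conj R[i]) (sn B) (cpx R).

Local Notation H := (completion hB).

HB.instance Definition _ := CompleteNormedModule.on H.

Lemma embed_subproof v : 
  ((fun u => B u v) : V -> cpx R) \in @bop_pred R Num.conj V (sn B) (cpx R).
Proof.
apply/asboolP; split=> [a x y|].
  by rewrite formDl// formZl.
by exists (sn B v) => u; rewrite mulrC ger0_norm ?sn_ge0//; exact: form_CS.
Qed.

Definition embed v : H := Bop (embed_subproof v).

Lemma embedE v u : bop_fun (embed v) u = B u v. Proof. by []. Qed.

Lemma embed_linear : linear embed.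
Proof.
by move=> a v w; apply: bop_eq => u; rewrite bopDE bopZE !embedE formDr// formZr.
Qed.

HB.instance Definition _ := GRing.isLinear.Build R[i] V H _ embed embed_linear.

Lemma bop_sn (f : H) u : normc (bop_fun f u) <= nm f * sn B u.
Proof. by rewrite -[X in _ * X]ger0_norm ?sn_ge0//; exact: (bop_normP f u). Qed.

Lemma nm_embed v : nm (embed v) = sn B v.
Proof.
apply/le_anti/andP; split.
  apply: bop_norm_le; first exact: sn_ge0.
  by move=> u; rewrite mulrC ger0_norm ?sn_ge0//; exact: form_CS.
by apply: (sn_le hB); [exact: nm_ge0|exact: (bop_sn (embed v))].
Qed.

(** The conjugate of an antilinear functional is linear and bounded, so approximate Riesz
    representation applies to it; the error of the representing vector is exactly a distance in the
    completion. *)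
Lemma embed_dense : dense_range embed.
Proof.
move=> f n.
have [||v hv] := @riesz_approx _ _ _ hB (fun u => Num.conj (bop_fun f u)) (nm f) _ _
  (eps R n) (eps_gt0 _ _).
- by move=> a x y; rewrite (bopP f).1 rmorphD rmorphM/= conjCK.
- by move=> x; rewrite normcJ bop_sn.
exists v; rewrite nm_dist; apply: bop_norm_le; first exact: eps_ge0.
move=> u; rewrite ger0_norm ?sn_ge0//; apply: le_trans (hv u).
rewrite -[leRHS]normcJ rmorphB/= conjCK -form_herm//; exact: lexx.
Qed.

Lemma cbop_additive (f : H) u v : bop_fun f (u - v) = bop_fun f u - bop_fun f v.
Proof.
have := (bopP f).1 (-1) v u; rewrite rmorphN rmorph1 !scaleN1r addrC => ->.
by rewrite addrC.
Qed.

(** The inner product of [embed v] with g has to be the value of g at v, so that of f with g is the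
    limit of these values as [embed v] tends to f. An estimate valid for all v determines this limit
    without reference to a chosen sequence. *)
Lemma completion_inner_ex (f g : H) : exists l : cpx R, forall v,
  nm ((bop_fun g v : cpx R) - l) <= nm g * nm (f - embed v).
Proof.
have /choice[r hr] := embed_dense f.
have hg v w : nm ((bop_fun g v : cpx R) - bop_fun g w) <=
    nm g * (nm (f - embed v) + nm (f - embed w)).
  rewrite -cbop_additive (le_trans (bop_sn _ _))// ler_wpM2l ?nm_ge0//.
  by rewrite -nm_embed linearB/= (le_trans (nm_tri f _ _))// nm_dist.
have [|l hl] := @fast_cvg R (cpx R) (fun n => bop_fun g (r n)) (nm g).
  by move=> n m; rewrite (le_trans (hg _ _))// ler_wpM2l ?nm_ge0// lerD.
exists l => v; apply: (@le_eps _ _ _ (2 * nm g)) => n.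
rewrite (le_trans (nm_tri (bop_fun g (r n) : cpx R) _ _))//.
have := hg v (r n); have := hl n; have := hr n; have := nm_ge0 g; nra.
Qed.

Definition cinner (f g : H) : R[i] := projT1 (cid (completion_inner_ex f g)).

Lemma cinnerP f g v : normc (bop_fun g v - cinner f g) <= nm g * nm (f - embed v).
Proof. exact: (projT2 (cid (completion_inner_ex f g))). Qed.

Lemma cinner_embed v g : cinner (embed v) g = bop_fun g v.
Proof.
apply/esym/(@eq_normc_eps _ _ _ 0) => n.
by rewrite (le_trans (cinnerP _ _ v))// subrr nm0 mulr0 mul0r.
Qed.

Lemma cinnerDr f g h : cinner f (g + h) = cinner f g + cinner f h.
Proof.
have /choice[r hr] := embed_dense f.
apply: (@eq_normc_eps _ _ _ (nm (g + h) + nm g + nm h)) => n.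
rewrite (le_trans (normc_tri (bop_fun (g + h) (r n)) _ _))// normc_dist.
rewrite -(addrA (nm _)) mulrDl.
rewrite lerD// ?(le_trans (cinnerP _ _ (r n)))// ?ler_wpM2l ?nm_ge0// bopDE.
rewrite opprD addrACA mulrDl (le_trans (le_normcD _ _))// lerD//;
  by rewrite (le_trans (cinnerP _ _ _))// ler_wpM2l ?nm_ge0.
Qed.

Lemma cinnerZr a f g : cinner f (a *: g) = a * cinner f g.
Proof.
have /choice[r hr] := embed_dense f.
apply: (@eq_normc_eps _ _ _ (nm (a *: g) + normc a * nm g)) => n.
rewrite (le_trans (normc_tri (bop_fun (a *: g) (r n)) _ _))// normc_dist mulrDl.
rewrite lerD// ?(le_trans (cinnerP _ _ (r n)))// ?ler_wpM2l ?nm_ge0//.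
rewrite bopZE -[X in _ - X]/(a * _) -mulrBr normcM -mulrA ler_wpM2l ?normc_ge0//.
by rewrite (le_trans (cinnerP _ _ _))// ler_wpM2l ?nm_ge0.
Qed.

Lemma sn_embed_le f v e : nm (f - embed v) <= e -> sn B v <= nm f + e.
Proof.
move=> h; rewrite -nm_embed -(subKr f (embed v)) (le_trans (nmB _ _))//.
by rewrite lerD2l.
Qed.

(** Replaces both arguments at once, so that symmetry and the norm identity descend from B. The
    condition e <= 1 absorbs the quadratic error term. *)
Lemma cinner_approx f g v w e :
  nm (f - embed v) <= e -> nm (g - embed w) <= e -> e <= 1 ->
  normc (cinner f g - B v w) <= (nm f + nm g + 1) * e.
Proof.
move=> hf hg e1; have e0 := le_trans (nm_ge0 _) hf.
rewrite (le_trans (normc_tri (bop_fun g v) _ _))// normc_dist.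
rewrite (le_trans (lerD (cinnerP f g v) (bop_sn (g - embed w) v)))//.
have := sn_embed_le hf; have := nm_ge0 g; have := nm_ge0 (g - embed w).
have := sn_ge0 B v; have := nm_ge0 f; nra.
Qed.

Lemma cinnerC f g : cinner f g = Num.conj (cinner g f).
Proof.
have /choice[r hr] := embed_dense f; have /choice[s hs] := embed_dense g.
apply: (@eq_normc_eps _ _ _ (2 * (nm f + nm g + 1))) => n.
rewrite (le_trans (normc_tri (B (r n) (s n)) _ _))//.
have := cinner_approx (hr n) (hs n) (eps_le1 R n).
have := cinner_approx (hs n) (hr n) (eps_le1 R n).
have -> : normc (B (r n) (s n) - Num.conj (cinner g f)) =
    normc (cinner g f - B (s n) (r n)).
  by rewrite [RHS]normc_dist -[RHS]normcJ rmorphB/= -(form_herm hB).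
lra.
Qed.

Lemma cinnerxx f : cinner f f = `|f| ^+ 2.
Proof.
have /choice[r hr] := embed_dense f.
rewrite nmE -rmorphXn; apply: (@eq_normc_eps _ _ _ (4 * nm f + 2)) => n.
rewrite (le_trans (normc_tri (B (r n) (r n)) _ _))//.
have := cinner_approx (hr n) (hr n) (eps_le1 R n).
have : normc (B (r n) (r n) - (nm f ^+ 2)%:C) <= (2 * nm f + 1) * eps R n.
  rewrite form_snE// -rmorphB normc_real.
  have h1 := sn_embed_le (hr n).
  have h2 : nm f <= sn B (r n) + eps R n.
    rewrite -nm_embed -[f in nm f](subrK (embed (r n))) addrC.
    by rewrite (le_trans (nmD _ _))// lerD2l.
  have := eps_le1 R n; have := eps_ge0 R n; have := sn_ge0 B (r n); have := nm_ge0 f.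
  rewrite ler_norml => *; apply/andP; split; nra.
lra.
Qed.

HB.instance Definition _ := isHilbert.Build R H cinnerDr cinnerZr cinnerC cinnerxx.

Lemma hilbert_completion : exists (K : hilbertType R) (j : {linear V -> K}),
  (forall v w, inner (j v) (j w) = B v w) /\ dense_range j.
Proof.
exists [the hilbertType R of H], embed; split; last exact: embed_dense.
by move=> v w; rewrite [LHS]cinner_embed embedE.
Qed.

End Completion.

(** * Riesz representation and adjoints *)

Section Hilbert.
Variables (R : realType) (H : hilbertType R).

Lemma inner_form : psd_form (@inner R H).
Proof.
split=> [x y z|a x y|x y z|a x y|x].
- by rewrite innerC innerDr rmorphD/= -!innerC.
- by rewrite innerC innerZr rmorphM/= -innerC.
- exact: innerDr.
- exact: innerZr.
- by rewrite innerxx exprn_ge0.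
Qed.

Lemma inner_nm (x : H) : inner x x = (nm x ^+ 2)%:C.
Proof. by rewrite innerxx nmE rmorphXn. Qed.

Lemma inner_sn : sn (@inner R H) = @nm R H.
Proof. by apply/funext => x; rewrite /sn inner_nm sqrtr_sqr ger0_norm ?nm_ge0. Qed.

Lemma inner_CS (x y : H) : normc (inner x y) <= nm x * nm y.
Proof. by rewrite -inner_sn; apply: form_CS inner_form _ _. Qed.

Lemma inner0l (x : H) : inner 0 x = 0.
Proof. by rewrite -(scale0r (0 : H)) (formZl inner_form) conj_real mul0r. Qed.

Lemma inner0r (x : H) : inner x 0 = 0.
Proof. by rewrite innerC inner0l conj_real. Qed.

Lemma inner_suml (I : Type) (r : seq I) (F : I -> H) (x : H) :
  inner (\sum_(i <- r) F i) x = \sum_(i <- r) inner (F i) x.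
Proof.
exact: (big_morph (inner ^~ x) (fun u v => formDl inner_form u v x) (inner0l x)).
Qed.

Lemma inner_sumr (I : Type) (r : seq I) (F : I -> H) (x : H) :
  inner x (\sum_(i <- r) F i) = \sum_(i <- r) inner x (F i).
Proof. exact: (big_morph (inner x) (innerDr x) (inner0r x)). Qed.

Lemma inner_eq (x y : H) : (forall z, inner z x = inner z y) -> x = y.
Proof.
move=> h; apply/eqP; rewrite -subr_eq0; apply/eqP/nm_eq0.
rewrite -inner_sn /sn (formBr inner_form) h subrr sqrtr0//.
Qed.

(** Approximate representing vectors satisfy [inner (r n - r m) u] <= (eps n + eps m) |u| in
    modulus; taking u = [r n - r m] shows that they converge, and their limit represents [phi]
    exactly. *)
Lemma riesz (phi : H -> R[i]) (M : R) :
  (forall a x y, phi (a *: x + y) = a * phi x + phi y) ->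
  (forall x, normc (phi x) <= M * nm x) -> exists z, forall u, phi u = inner z u.
Proof.
move=> phil phiM.
have /choice[r hr] n : exists x : H,
    forall u, normc (inner x u - phi u) <= eps R n * nm u.
  rewrite -inner_sn; apply: (riesz_approx inner_form phil) (eps_gt0 R n).
  by rewrite inner_sn; exact: phiM.
have [n m|z hz] := @fast_cvg R H r 1.
  rewrite mul1r -inner_sn; apply: (sn_le inner_form).
    by rewrite addr_ge0// eps_ge0.
  rewrite {1}(formBl inner_form) inner_sn mulrDl.
  rewrite (le_trans (normc_tri (phi (r n - r m)) _ _))// lerD//.
  by rewrite normc_dist.
exists z => u; apply: (@eq_normc_eps _ _ _ (2 * nm u)) => n.
rewrite (le_trans (normc_tri (inner (r n) u) _ _))//.
rewrite -(formBl inner_form); have := inner_CS (r n - z) u.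
have := hr n u; rewrite normc_dist; have := hz n; have := nm_ge0 u; nra.
Qed.

Section Adjoint.
Variables (T : H -> H) (c : R).
Hypotheses (Tl : linear T) (Tc : forall x, nm (T x) <= c * nm x).

Lemma adjointP x y : inner (T x) y = inner x (adjoint T y).
Proof.
suff [z hz] : exists z, forall x, inner (T x) y = inner x z.
  by rewrite /adjoint; case: xgetP => [z' _ -> //|/(_ z)[]].
have [|u|z hz] := @riesz (fun u => inner y (T u)) (nm y * c).
- by move=> a u v; rewrite Tl innerDr innerZr.
- by rewrite (le_trans (inner_CS _ _))// -mulrA ler_wpM2l// nm_ge0.
by exists z => u; rewrite innerC hz -innerC.
Qed.

Lemma adjoint_linear : linear (adjoint T).
Proof.
move=> a x y; apply: inner_eq => z.
by rewrite -adjointP !innerDr !innerZr -!adjointP.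
Qed.

Lemma adjoint_bound y : nm (adjoint T y) <= c * nm y.
Proof.
(* The sign of [c] is not given; only a nonzero vector forces c >= 0. *)
have [y0|y0] := eqVneq y 0.
  rewrite {2}y0 nm0 mulr0 y0; suff -> : adjoint T 0 = 0 by rewrite nm0.
  by apply: inner_eq => z; rewrite -adjointP !inner0r.
have c0 : 0 <= c.
  have := le_trans (nm_ge0 _) (Tc y).
  rewrite pmulr_lge0// lt_neqAle nm_ge0 andbT eq_sym.
  by apply: contra y0 => /eqP y0; apply/eqP/nm_eq0; rewrite y0.
rewrite -inner_sn; apply: (sn_le inner_form).
  by rewrite mulr_ge0// inner_sn nm_ge0.
rewrite -adjointP inner_sn (le_trans (inner_CS _ _))//.
by rewrite mulrAC ler_wpM2r// nm_ge0.
Qed.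

End Adjoint.

Lemma adjointE (T S : H -> H) :
  (forall x y, inner (T x) y = inner x (S y)) -> adjoint T = S.
Proof.
move=> h; apply/funext => y; apply: inner_eq => x; rewrite -h.
by rewrite /adjoint; case: xgetP => [z' _ -> //|/(_ (S y))[]].
Qed.

(** The difference x - y is orthogonal to every [j v], so subtracting a nearby [j v] from its left
    copy leaves its squared norm unchanged; Cauchy-Schwarz then makes it small. *)
Lemma inner_eq_dense (V : Type) (j : V -> H) (x y : H) :
  dense_range j -> (forall v, inner (j v) x = inner (j v) y) -> x = y.
Proof.
move=> dj h; apply/eqP; rewrite -subr_eq0; apply/eqP/nm_eq0.
have h2 : nm (x - y) ^+ 2 <= 0.
  apply: (@le_eps0 _ _ (nm (x - y))) => n; have [v hv] := dj (x - y) n.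
  have -> : nm (x - y) ^+ 2 = normc (inner (x - y - j v) (x - y)).
    rewrite (formBl inner_form) (formBr inner_form (j v)) h subrr subr0.
    rewrite inner_nm normc_real.
    by rewrite ger0_norm// sqr_ge0.
  by rewrite (le_trans (inner_CS _ _))// mulrC ler_wpM2l// nm_ge0.
by have := nm_ge0 (x - y); nra.
Qed.

End Hilbert.

(** * Isometries and maps determined on a dense range *)

Lemma isometry_inner (R : realType) (H K : hilbertType R) (T : {linear H -> K}) :
  (forall x, nm (T x) = nm x) -> forall x y, inner (T x) (T y) = inner x y.
Proof.
move=> Tn x y.
have hT z : inner (T z) (T z) = inner z z by rewrite !inner_nm Tn.
(* Polarization again: x + y gives the real parts and x + iy the imaginary parts. *)
have := hT (x + 'i%C *: y); have := hT (x + y); rewrite !linearD !linearZ.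
rewrite !(formDl (inner_form _)) !innerDr !(formZl (inner_form _)) !innerZr !hT.
rewrite (innerC (T y) (T x)) (innerC y x).
case: (inner (T x) (T y)) => a b; case: (inner x y) => a' b'.
case: (inner x x) => e e'; case: (inner y y) => f f' [h1 _] [h2 _].
apply/eqP; rewrite eq_complex /=; apply/andP.
by split; apply/eqP; move: h1 h2 => /=; lra.
Qed.

Lemma dense_extension (R : realType) (V : lmodType R[i]) (H : normedModType R[i])
    (W : completeNormedModType R[i]) (j : {linear V -> H}) (q : {linear V -> W}) (c : R) :
  0 <= c -> dense_range j -> (forall v, nm (q v) <= c * nm (j v)) ->
  exists T : {linear H -> W},
    (forall v, T (j v) = q v) /\ forall x, nm (T x) <= c * nm x.
Proof.
move=> c0 dj qj.
have qq x v w : nm (q v - q w) <= c * (nm (x - j v) + nm (x - j w)).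
  rewrite -linearB (le_trans (qj _))// ler_wpM2l// linearB/=.
  by rewrite (le_trans (nm_tri x _ _))// nm_dist.
(* Comparing [T x] with all [q v], and not just with an approximating sequence, is what yields
   [T (j v) = q v] at once, even if j is not injective. *)
have /choice[T TP] x : exists y, forall v, nm (y - q v) <= c * nm (x - j v).
  have /choice[r hr] := dj x.
  have [n m|y hy] := @fast_cvg R W (q \o r) c.
    by rewrite (le_trans (qq x _ _))// ler_wpM2l// lerD.
  exists y => v; apply: (@le_eps _ _ _ (2 * c)) => n.
  rewrite (le_trans (nm_tri (q (r n)) _ _))//.
  have := qq x (r n) v; have := hy n; have := hr n; rewrite nm_dist/=; nra.
have Tj v : T (j v) = q v.
  apply: (@eq_nm_eps _ _ _ _ 0) => n.
  by rewrite (le_trans (TP _ v))// subrr nm0 mulr0 mul0r.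
have Tl : linear T.
  move=> a x y; have /choice[r hr] := dj x; have /choice[s hs] := dj y.
  apply: (@eq_nm_eps _ _ _ _ (2 * c * (normc a + 1))) => n.
  have h1 : nm (a *: x + y - j (a *: r n + s n)) <= normc a * eps R n + eps R n.
    rewrite linearD linearZ/= opprD addrACA -scalerBr.
    by rewrite (le_trans (nmD _ _))// nmZ lerD// ler_wpM2l// normc_ge0.
  rewrite (le_trans (nm_tri (q (a *: r n + s n)) _ _))//.
  have -> : q (a *: r n + s n) - (a *: T x + T y) =
      - (a *: (T x - q (r n)) + (T y - q (s n))).
    by rewrite linearD linearZ/= scalerBr addrACA -opprD opprB.
  have := TP (a *: x + y) (a *: r n + s n).
  have := nmD (a *: (T x - q (r n))) (T y - q (s n)); rewrite nmN nmZ.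
  have := TP x (r n); have := TP y (s n); have := hr n; have := hs n.
  have := normc_ge0 a; have := nm_ge0 (T x - q (r n)).
  move: h1; move: (normc a) (nm (T x - q (r n))) => A X h1 hA hX h2 h3 h4 h5 h6 h7.
  have : A * X <= A * (c * eps R n) by rewrite ler_wpM2l// (le_trans h5)// ler_wpM2l.
  have : c * nm (y - j (s n)) <= c * eps R n by rewrite ler_wpM2l.
  have : c * nm (a *: x + y - j (a *: r n + s n)) <= c * (A * eps R n + eps R n).
    by rewrite ler_wpM2l.
  lra.
pose mT := GRing.isLinear.Build R[i] H W _ T Tl.
pose T' : {linear H -> W} := HB.pack T mT.
exists T'; split=> // x; have /choice[r hr] := dj x.
apply: (@le_eps _ _ _ (2 * c)) => n.
have := TP x (r n); have := nmD (T x - q (r n)) (q (r n)); rewrite subrK.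
have := qj (r n); have := hr n; have := nmB x (x - j (r n)).
rewrite subKr => h1 h2 h3 h4 h5.
have : c * nm (x - j (r n)) <= c * eps R n by rewrite ler_wpM2l.
have : c * nm (j (r n)) <= c * (nm x + nm (x - j (r n))) by rewrite ler_wpM2l.
lra.
Qed.

Lemma dense_unique (R : realType) (V : Type) (H W : normedModType R[i])
    (j : V -> H) (S T : {linear H -> W}) (c d : R) :
  dense_range j -> (forall x, nm (S x) <= c * nm x) -> (forall x, nm (T x) <= d * nm x) ->
  (forall v, S (j v) = T (j v)) -> S =1 T.
Proof.
move=> dj Sc Td ST x; have /choice[r hr] := dj x.
apply: (@eq_nm_eps _ _ _ _ (`|c| + `|d|)) => n.
rewrite (le_trans (nm_tri (S (j (r n))) _ _))// [in X in _ + X]ST.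
rewrite -!linearB -(nmN (T _)) -linearN opprB.
rewrite (le_trans (lerD (Sc _) (Td _)))// -mulrDl.
rewrite (@le_trans _ _ ((`|c| + `|d|) * nm (x - j (r n))))//.
  by rewrite ler_wpM2r ?nm_ge0// lerD// ler_norm.
by rewrite ler_wpM2l// addr_ge0.
Qed.

(** * The C*-algebra of bounded operators *)

Section OperatorAlgebra.
Variables (R : realType) (H : hilbertType R).

Definition operators : Type := bop (@id R[i]) (@nm R H) H.

HB.instance Definition _ := CompleteNormedModule.on operators.

Implicit Types f g h : operators.

Lemma opl f : linear f. Proof. exact: (bopP f).1. Qed.

Lemma op_nm f x : nm (bop_fun f x) <= nm f * nm x.
Proof. by rewrite -[X in _ * X]ger0_norm ?nm_ge0//; exact: (bop_normP f x). Qed.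

Lemma op_nm_le f c : 0 <= c -> (forall x, nm (bop_fun f x) <= c * nm x) -> nm f <= c.
Proof. by move=> c0 h; apply: bop_norm_le => // x; rewrite ger0_norm ?nm_ge0. Qed.

Lemma op_subproof (T : H -> H) (c : R) :
  linear T -> (forall x, nm (T x) <= c * nm x) ->
  T \in @bop_pred R id H (@nm R H) H.
Proof.
move=> Tl Tc; apply/asboolP; split=> //.
by exists c => x; rewrite ger0_norm ?nm_ge0.
Qed.

Definition op_of (T : H -> H) (c : R) (Tl : linear T)
  (Tc : forall x, nm (T x) <= c * nm x) : operators := Bop (op_subproof Tl Tc).

Lemma comp_linear f g : linear (bop_fun f \o bop_fun g).
Proof. by move=> a x y; rewrite /= !opl. Qed.

Lemma comp_bound f g x : nm ((bop_fun f \o bop_fun g) x) <= (nm f * nm g) * nm x.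
Proof.
by rewrite (le_trans (op_nm _ _))// -mulrA ler_wpM2l ?nm_ge0// op_nm.
Qed.

Lemma id_bound (x : H) : nm (id x) <= 1 * nm x. Proof. by rewrite mul1r. Qed.

Definition opM f g : operators := op_of (comp_linear f g) (comp_bound f g).
Definition op1 : operators := @op_of id 1 (fun _ _ _ => erefl) id_bound.
Definition opJ f : operators :=
  op_of (adjoint_linear (opl f) (op_nm f)) (adjoint_bound (opl f) (op_nm f)).

Lemma opJP f x y : inner (bop_fun f x) y = inner x (bop_fun (opJ f) y).
Proof. exact: adjointP (opl f) (op_nm f) _ _. Qed.

Lemma opJ_unique f g :
  (forall x y, inner (bop_fun f x) y = inner x (bop_fun g y)) -> opJ f = g.
Proof. by move=> h; apply: bop_eq => x; rewrite /= (adjointE h). Qed.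

Lemma opMA : associative opM. Proof. by move=> f g h; apply: bop_eq. Qed.
Lemma op1M : left_id op1 opM. Proof. by move=> f; apply: bop_eq. Qed.
Lemma opM1 : right_id op1 opM. Proof. by move=> f; apply: bop_eq. Qed.
Lemma opMDl : left_distributive opM +%R.
Proof. by move=> f g h; apply: bop_eq. Qed.

Lemma opD f x y : bop_fun f (x + y) = bop_fun f x + bop_fun f y.
Proof. by have := opl f 1 x y; rewrite !scale1r. Qed.

Lemma op0 f : bop_fun f 0 = 0.
Proof. by apply/nm_eq0; rewrite (le_trans (op_nm _ _))// nm0 mulr0. Qed.

Lemma opZ f a x : bop_fun f (a *: x) = a *: bop_fun f x.
Proof. by have := opl f a x 0; rewrite !addr0 op0 addr0. Qed.

Lemma opMDr : right_distributive opM +%R.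
Proof. by move=> f g h; apply: bop_eq => x; rewrite bopDE /= opD. Qed.
Lemma opMZl (a : R[i]) f g : opM (a *: f) g = a *: opM f g.
Proof. exact: bop_eq. Qed.
Lemma opMZr (a : R[i]) f g : opM f (a *: g) = a *: opM f g.
Proof. by apply: bop_eq => x; rewrite bopZE /= opZ. Qed.

Lemma opJD f g : opJ (f + g) = opJ f + opJ g.
Proof.
apply: opJ_unique => x y.
by rewrite !bopDE innerDr (formDl (inner_form H)) !opJP.
Qed.

Lemma opJZ (a : R[i]) f : opJ (a *: f) = Num.conj a *: opJ f.
Proof.
by apply: opJ_unique => x y; rewrite !bopZE innerZr (formZl (inner_form H)) opJP.
Qed.

Lemma opJM f g : opJ (opM f g) = opM (opJ g) (opJ f).
Proof. by apply: opJ_unique => x y; rewrite /= opJP opJP. Qed.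

Lemma opJK : involutive opJ.
Proof. by move=> f; apply: opJ_unique => x y; rewrite innerC -opJP -innerC. Qed.

Lemma opM_nm f g : nm (opM f g) <= nm f * nm g.
Proof. by apply: op_nm_le => [|x]; [rewrite mulr_ge0 ?nm_ge0|exact: comp_bound]. Qed.

Lemma opJ_nm f : nm (opJ f) <= nm f.
Proof.
apply: op_nm_le => [|x]; first exact: nm_ge0.
exact: adjoint_bound (opl f) (op_nm f) x.
Qed.

(** The nontrivial inequality comes from |f x|^2 = <x | f^* f x> <= |f^* f| |x|^2. *)
Lemma op_cstar_nm f : nm (opM (opJ f) f) = nm f ^+ 2.
Proof.
have f0 := nm_ge0 f; set s := Num.sqrt (nm (opM (opJ f) f)).
have s2 : s ^+ 2 = nm (opM (opJ f) f) by rewrite sqr_sqrtr ?nm_ge0.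
apply/le_anti/andP; split.
  by rewrite (le_trans (opM_nm _ _))// expr2 ler_wpM2r// opJ_nm.
rewrite -s2 ler_sqr ?nnegrE ?sqrtr_ge0//.
apply: op_nm_le => [|x]; first exact: sqrtr_ge0.
have sx : 0 <= s * nm x by rewrite mulr_ge0 ?sqrtr_ge0 ?nm_ge0.
rewrite -ler_sqr ?nnegrE ?nm_ge0//.
have -> : nm (bop_fun f x) ^+ 2 = normc (inner x (bop_fun (opM (opJ f) f) x)).
  by rewrite /= -[LHS]ger0_norm ?sqr_ge0// -normc_real -inner_nm opJP.
rewrite (le_trans (inner_CS _ _))// exprMn s2 expr2 mulrCA ler_wpM2l ?nm_ge0//.
exact: op_nm.
Qed.

Lemma opM_norm f g : `|opM f g| <= `|f| * `|g|.
Proof. by rewrite !nmE -rmorphM lecR opM_nm. Qed.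

Lemma op_cstar f : `|opM (opJ f) f| = `|f| ^+ 2.
Proof. by rewrite !nmE op_cstar_nm rmorphXn. Qed.

HB.instance Definition _ := isCStarAlgebra.Build R operators
  opMA op1M opM1 opMDl opMDr opMZl opMZr opJD opJZ opJM opJK opM_norm op_cstar.

Lemma cmul_opE f g x : bop_fun (cmul f g) x = bop_fun f (bop_fun g x).
Proof. by []. Qed.

Lemma cone_opE x : bop_fun (cone : operators) x = x.
Proof. by []. Qed.

Lemma star_opP f x y : inner (bop_fun f x) y = inner x (bop_fun (star f) y).
Proof. exact: opJP. Qed.

Lemma sum_opE (I : finType) (F : I -> operators) x :
  bop_fun (\sum_i F i) x = \sum_i bop_fun (F i) x.
Proof. exact: (big_morph (fun f : operators => bop_fun f x)). Qed.

End OperatorAlgebra.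

(** * Positive semidefinite kernels *)

Section FiniteSupport.
Variables (R : realType) (X : choiceType).

Definition fsupp_pred : {pred X -> R[i]} := fun f => `[< finite_set [set x | f x != 0] >].

(** The free complex vector space on [X], whose elements are the coefficient functions of the
    positivity and cyclicity conditions. *)
Record fsupp := Fsupp { fsupp_fun :> X -> R[i]; fsupp_funP : fsupp_fun \in fsupp_pred }.

HB.instance Definition _ := [isSub for fsupp_fun].
HB.instance Definition _ := [Choice of fsupp by <:].

Lemma fsupp_submod_closed : submod_closed fsupp_pred.
Proof.
split=> [|a f g /asboolP ff /asboolP fg]; apply/asboolP.
  by apply: (sub_finite_set _ (finite_set0 X)) => x /=; rewrite eqxx.
apply: (@sub_finite_set _ _ ([set x | f x != 0] `|` [set x | g x != 0])).
  move=> x /=; rewrite !fctE; have [->|] := eqVneq (f x) 0; last by left.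
  by rewrite scaler0 add0r; right.
by rewrite finite_setU.
Qed.

HB.instance Definition _ :=
  GRing.isSubmodClosed.Build R[i] (X -> R[i]) fsupp_pred fsupp_submod_closed.
HB.instance Definition _ := [SubChoice_isSubLmodule of fsupp by <:].

Implicit Types f g : fsupp.

Lemma fsuppP f : finite_set [set x | f x != 0].
Proof. exact/asboolP/fsupp_funP. Qed.

Lemma fsuppE a f g x : (a *: f + g) x = a * f x + g x. Proof. by []. Qed.

Definition fsupp_of (l : X -> R[i]) (hl : finite_set [set x | l x != 0]) : fsupp :=
  Fsupp (introT (asboolP _) hl).

Definition supp f : {fset X} := fset_set [set x | f x != 0].

Lemma supp_notin f x : x \notin supp f -> f x = 0.
Proof.
rewrite /supp in_fset_set; last exact: fsuppP.
by rewrite notin_setE /= => /negP; rewrite negbK => /eqP.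
Qed.

(** Any finite set containing the support may be used, so several functions can be summed over one
    common set. *)
Lemma fsupp_sum (E : zmodType) (F : X -> R[i] -> E) (r : {fset X}) f :
  (forall x, F x 0 = 0) -> (forall x, x \notin r -> f x = 0) ->
  \sum_(x \in [set: X]) F x (f x) = \sum_(x <- r) F x (f x).
Proof. by move=> F0 fr; apply: fsbigTE => x /fr ->; rewrite F0. Qed.

Lemma fsupp_sum2 (E : zmodType) (F : X -> X -> R[i] -> R[i] -> E) (r : {fset X}) f g :
  (forall x y a, F x y 0 a = 0) -> (forall x y a, F x y a 0 = 0) ->
  (forall x, x \notin r -> f x = 0) -> (forall x, x \notin r -> g x = 0) ->
  \sum_(x \in [set: X]) \sum_(y \in [set: X]) F x y (f x) (g y) =
  \sum_(x <- r) \sum_(y <- r) F x y (f x) (g y).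
Proof.
move=> F0l F0r fr gr.
have h x : \sum_(y \in [set: X]) F x y (f x) (g y) = \sum_(y <- r) F x y (f x) (g y).
  by apply: (@fsupp_sum _ (fun y => F x y (f x))).
under eq_fsbigr do rewrite h.
apply: (@fsupp_sum _ (fun x a => \sum_(y <- r) F x y a (g y))) => // x.
by rewrite big1.
Qed.

Section Lincomb.
Variables (E : lmodType R[i]) (a : X -> E).

Definition lincomb f : E := \sum_(x \in [set: X]) f x *: a x.

Lemma lincombE (r : {fset X}) f : (forall x, x \notin r -> f x = 0) ->
  lincomb f = \sum_(x <- r) f x *: a x.
Proof. by apply: (@fsupp_sum _ (fun x b => b *: a x)) => x; rewrite scale0r. Qed.

Lemma lincomb_linear : linear lincomb.
Proof.
move=> b f g; pose r := (supp f `|` supp g)%fset.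
have fr x : x \notin r -> f x = 0 by rewrite inE negb_or => /andP[/supp_notin].
have gr x : x \notin r -> g x = 0 by rewrite inE negb_or => /andP[_ /supp_notin].
rewrite !(@lincombE r)//; last by move=> x xr; rewrite fsuppE fr// gr// mulr0 addr0.
rewrite scaler_sumr -big_split /=; apply: eq_bigr => x _.
by rewrite scalerA -scalerDl.
Qed.

HB.instance Definition _ := GRing.isLinear.Build R[i] fsupp E _ lincomb lincomb_linear.

End Lincomb.

Lemma raddf_lincomb (E F : lmodType R[i]) (T : {linear E -> F}) (a : X -> E) f :
  T (lincomb a f) = lincomb (T \o a) f.
Proof.
rewrite !(lincombE _ (@supp_notin f)) linear_sum /=.
by apply: eq_bigr => x _; rewrite linearZ.
Qed.

Lemma delta_subproof x : finite_set [set y : X | (if y == x then 1 else 0 : R[i]) != 0].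
Proof.
apply: (sub_finite_set _ (finite_set1 x)) => y /=.
by have [->//|_] := eqVneq y x; rewrite eqxx.
Qed.

Definition delta x : fsupp := fsupp_of (delta_subproof x).

Lemma lincomb_delta (E : lmodType R[i]) (a : X -> E) x : lincomb a (delta x) = a x.
Proof.
rewrite (@lincombE _ _ [fset x]%fset) => [|y]; last by rewrite inE /= => /negPf ->.
by rewrite big_seq_fset1 /= eqxx scale1r.
Qed.

Definition kernel_form (k : X -> X -> R[i]) f g : R[i] :=
  \sum_(x \in [set: X]) \sum_(y \in [set: X]) Num.conj (f x) * k x y * g y.

Lemma kernel_formE k (r : {fset X}) f g :
  (forall x, x \notin r -> f x = 0) -> (forall x, x \notin r -> g x = 0) ->
  kernel_form k f g = \sum_(x <- r) \sum_(y <- r) Num.conj (f x) * k x y * g y.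
Proof.
apply: (@fsupp_sum2 _ (fun x y b c => Num.conj b * k x y * c)) => x y a.
  by rewrite rmorph0 !mul0r.
by rewrite mulr0.
Qed.

Lemma form_lincomb (E : lmodType R[i]) (B : E -> E -> R[i]) (a b : X -> E) f g :
  psd_form B ->
  B (lincomb a f) (lincomb b g) = kernel_form (fun x y => B (a x) (b y)) f g.
Proof.
move=> hB; pose r := (supp f `|` supp g)%fset.
have fr x : x \notin r -> f x = 0 by rewrite inE negb_or => /andP[/supp_notin].
have gr x : x \notin r -> g x = 0 by rewrite inE negb_or => /andP[_ /supp_notin].
have B0l y : B 0 y = 0 by have := formBl hB 0 0 y; rewrite !subrr.
have B0r y : B y 0 = 0 by have := formBr hB y 0 0; rewrite !subrr.
rewrite (kernel_formE _ fr gr) (lincombE a fr) (lincombE b gr).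
rewrite (big_morph (fun u => B u _) (fun u v => formDl hB u v _) (B0l _)).
apply: eq_bigr => x _; rewrite (big_morph _ (formDr hB _) (B0r _)).
apply: eq_bigr => y _.
by rewrite formZl// formZr// mulrA mulrAC.
Qed.

Lemma lincomb_inner (H : hilbertType R) (a b : X -> H) f g :
  inner (lincomb a f) (lincomb b g) = kernel_form (fun x y => inner (a x) (b y)) f g.
Proof. exact: (form_lincomb _ _ _ _ (inner_form H)). Qed.

Lemma kernel_form_sum (I : finType) (k : I -> X -> X -> R[i]) f g :
  \sum_i kernel_form (k i) f g = kernel_form (fun x y => \sum_i k i x y) f g.
Proof.
pose r := (supp f `|` supp g)%fset.
have fr x : x \notin r -> f x = 0 by rewrite inE negb_or => /andP[/supp_notin].
have gr x : x \notin r -> g x = 0 by rewrite inE negb_or => /andP[_ /supp_notin].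
under eq_bigr do rewrite (kernel_formE _ fr gr).
rewrite (kernel_formE _ fr gr) exchange_big /=; apply: eq_bigr => x _.
rewrite exchange_big /=; apply: eq_bigr => y _.
by rewrite mulr_sumr mulr_suml.
Qed.

Lemma eq_kernel_form k k' f g : k =2 k' -> kernel_form k f g = kernel_form k' f g.
Proof. by move=> kk; have -> : k = k' by apply/funext => x; apply/funext => y. Qed.

Lemma kernel_form_psd k : (forall f, 0 <= kernel_form k f f) -> psd_form (kernel_form k).
Proof.
move=> kpos.
have hr2 (f g : fsupp) : exists r : {fset X}, forall x, x \notin r -> f x = 0 /\ g x = 0.
  exists (supp f `|` supp g)%fset => x.
  by rewrite inE negb_or => /andP[/supp_notin -> /supp_notin ->].
have hr3 (f g h : fsupp) : exists r : {fset X},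
    forall x, x \notin r -> [/\ f x = 0, g x = 0 & h x = 0].
  have [r hr] := hr2 f g; exists (r `|` supp h)%fset => x.
  by rewrite inE negb_or => /andP[/hr[-> ->] /supp_notin ->].
have kE (r : {fset X}) (f g : fsupp) : (forall x, x \notin r -> f x = 0 /\ g x = 0) ->
    kernel_form k f g = \sum_(x <- r) \sum_(y <- r) Num.conj (f x) * k x y * g y.
  by move=> h; apply: kernel_formE => x /h[].
split=> // [f g h|a f g|f g h|a f g].
- have [r hr] := hr3 f g h.
  rewrite !(kE r); [|by move=> x /hr[]..|]; last first.
    by move=> x /hr[f0 g0 ->]; rewrite -[f]scale1r fsuppE f0 g0 mulr0 addr0.
  rewrite -big_split /=; apply: eq_bigr => x _; rewrite -big_split /=.
  by apply: eq_bigr => y _; rewrite rmorphD/= !mulrDl.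
- have [r hr] := hr2 f g.
  rewrite !(kE r); [|by move=> x /hr[]..|]; last first.
    by move=> x /hr[f0 ->]; rewrite -[_ *: f]addr0 fsuppE f0 mulr0 addr0.
  rewrite mulr_sumr; apply: eq_bigr => x _; rewrite mulr_sumr.
  by apply: eq_bigr => y _; rewrite rmorphM/= !mulrA.
- have [r hr] := hr3 f g h.
  rewrite !(kE r); [|by move=> x /hr[]..|]; last first.
    by move=> x /hr[-> g0 h0]; rewrite -[g]scale1r fsuppE g0 h0 mulr0 addr0.
  rewrite -big_split /=; apply: eq_bigr => x _; rewrite -big_split /=.
  by apply: eq_bigr => y _; rewrite -mulrDr.
- have [r hr] := hr2 f g.
  rewrite !(kE r); [|by move=> x /hr[]..|]; last first.
    by move=> x /hr[-> g0]; rewrite -[_ *: g]addr0 fsuppE g0 mulr0 addr0.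
  rewrite mulr_sumr; apply: eq_bigr => x _; rewrite mulr_sumr.
  by apply: eq_bigr => y _; rewrite -[(a *: g) y]/(a * g y) mulrCA.
Qed.

(** The Kolmogorov decomposition of a positive semidefinite kernel: complete the free space on [X]
    under the kernel form and take the images of the point masses. *)
Lemma kolmogorov k : (forall f, 0 <= kernel_form k f f) ->
  exists (H : hilbertType R) (v : X -> H),
    (forall x y, inner (v x) (v y) = k x y) /\ dense_range (lincomb v).
Proof.
move=> kpos; have [H [j [ji jd]]] := hilbert_completion (kernel_form_psd kpos).
exists H, (j \o delta); split=> [x y|].
  rewrite ji (@kernel_formE _ [fset x; y]%fset) => [|z|z].
  - rewrite (bigD1_seq x) ?fset_uniq ?in_fsetE ?eqxx//= [X in _ + X]big1; last first.
      by move=> z /negPf zx; apply: big1 => t _; rewrite zx rmorph0 !mul0r.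
    rewrite addr0 (bigD1_seq y) ?fset_uniq ?in_fsetE ?eqxx ?orbT//= [X in _ + X]big1.
      by rewrite rmorph1 mul1r mulr1 addr0.
    by move=> z /negPf zx; rewrite zx mulr0.
  - by rewrite !inE negb_or => /andP[/negPf /= ->].
  - by rewrite !inE negb_or => /andP[_ /negPf /= ->].
(* Every finitely supported function is the combination of point masses with its own values, so
   density of [j] is density of the span. *)
have jE f : lincomb (j \o delta) f = j f.
  rewrite -raddf_lincomb; congr (j _).
  apply/val_inj/funext => x /=.
  have : (lincomb delta f) x = \sum_(y <- supp f) f y * (delta y) x.
    rewrite (lincombE _ (@supp_notin f)).
    by elim/big_rec2: _ => // y u w _ <-; rewrite fsuppE.
  move=> ->; have [xf|xf] := boolP (x \in supp f).
    rewrite (bigD1_seq x) ?fset_uniq//= eqxx mulr1 big1 ?addr0// => y.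
    by rewrite eq_sym => /negPf ->; rewrite mulr0.
  rewrite big1_seq ?(supp_notin xf)// => y /andP[_ yf].
  rewrite /=; have [xy|_] := eqVneq x y; last by rewrite mulr0.
  by case/negP: xf; rewrite xy.
by move=> x n; have [f hf] := jd x n; exists f; rewrite jE.
Qed.

End FiniteSupport.

(** * Cuntz objects and their kernels *)

Section CuntzObjects.
Variables (R : realType) (d : nat).

Definition vec (X : cuntz_object R d) (I : seq 'I_d) : space X :=
  word_adjoint (ops X) I (vac X).

Lemma vec_rcons X I i : vec X (rcons I i) = adjoint (ops X i) (vec X I).
Proof. by rewrite /vec /word_adjoint foldl_rcons. Qed.

Lemma ops_adjointP (X : cuntz_object R d) i x y :
  inner (ops X i x) y = inner x (adjoint (ops X i) y).
Proof.
have /bounded_nm[c hc] := ops_bounded X i.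
exact: adjointP (linearP (ops X i)) hc x y.
Qed.

Lemma ops_adjoint (X : cuntz_object R d) i :
  exists (A : {linear space X -> space X}) (c : R),
  adjoint (ops X i) = A /\ forall x, nm (A x) <= c * nm x.
Proof.
have /bounded_nm[c hc] := ops_bounded X i.
pose mA := GRing.isLinear.Build R[i] (space X) (space X) _ (adjoint (ops X i))
  (adjoint_linear (linearP (ops X i)) hc).
pose A : {linear space X -> space X} := HB.pack (adjoint (ops X i)) mA.
exists A, c; split=> // x.
exact: adjoint_bound (linearP (ops X i)) hc x.
Qed.

Lemma vec_dense X : dense_range (lincomb (vec X)).
Proof.
move=> x n; have /dense_nm/(_ x _ (eps_gt0 R n))[_ [l [hl ->]] xl] := @vac_cyclic _ _ X.
by exists (fsupp_of hl); rewrite ltW.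
Qed.

Definition object_kernel X I J : R[i] := inner (vec X I) (vec X J).

Lemma object_kernelP X : is_cuntz_kernel (object_kernel X).
Proof.
split=> [|l hl|I J].
- by rewrite /object_kernel innerxx vac_unit expr1n.
- have -> : \sum_(I \in [set: seq 'I_d]) \sum_(J \in [set: seq 'I_d])
      Num.conj (l I) * object_kernel X I J * l J =
    inner (lincomb (vec X) (fsupp_of hl)) (lincomb (vec X) (fsupp_of hl)).
    by rewrite lincomb_inner.
  by rewrite innerxx exprn_ge0.
(* Moving one adjoint across the inner product makes the sum of the V_i V_i^* appear. *)
rewrite /object_kernel; under eq_bigr do rewrite !vec_rcons -ops_adjointP.
rewrite -[in RHS](ops_sum (vec X I)).
by rewrite inner_suml.
Qed.

Lemma unitary_object_kernel X Y : unitary_equivalent X Y ->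
  object_kernel X = object_kernel Y.
Proof.
move=> [U [[S US SU] Ui Uvac Uops]].
have Uadj i x : U (adjoint (ops X i) x) = adjoint (ops Y i) (U x).
  apply: inner_eq => z; rewrite -(SU z) Ui -!ops_adjointP -Ui.
  by rewrite Uops.
have Uvec I : U (vec X I) = vec Y I.
  by elim/last_ind: I => [//|I i IH]; rewrite !vec_rcons Uadj IH.
by apply/funext => I; apply/funext => J; rewrite /object_kernel -!Uvec Ui.
Qed.

Lemma object_kernel_isometry X Y : object_kernel X = object_kernel Y ->
  exists T : {linear space X -> space Y},
    (forall f, T (lincomb (vec X) f) = lincomb (vec Y) f) /\
    forall x, nm (T x) <= 1 * nm x.
Proof.
move=> XY; apply: dense_extension => [//||f]; first exact: vec_dense.
rewrite mul1r -!inner_sn /sn !lincomb_inner.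
by rewrite -[X in kernel_form X]/(object_kernel Y) -XY.
Qed.

(** On the spanning vectors only the adjoints act explicitly, by appending a letter. Hence the
    unitary is shown to intertwine the V_i^* first, by density, and then the V_i by taking
    adjoints. *)
Lemma object_kernel_unitary X Y : object_kernel X = object_kernel Y ->
  unitary_equivalent X Y.
Proof.
move=> XY; have [T [Tj T1]] := object_kernel_isometry XY.
have [S [Sj S1]] := object_kernel_isometry (esym XY).
have id_le (H : hilbertType R) (x : H) : nm (idfun x) <= 1 * nm x by rewrite mul1r.
have ST : cancel T S.
  have h x : nm ((S \o T) x) <= 1 * nm x.
    by rewrite /= mul1r (le_trans (S1 _))// mul1r (le_trans (T1 _))// mul1r.
  by apply: (dense_unique (@vec_dense X) h (id_le _)) => f /=; rewrite Tj Sj.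
have TS : cancel S T.
  have h x : nm ((T \o S) x) <= 1 * nm x.
    by rewrite /= mul1r (le_trans (T1 _))// mul1r (le_trans (S1 _))// mul1r.
  by apply: (dense_unique (@vec_dense Y) h (id_le _)) => f /=; rewrite Sj Tj.
have Tn x : nm (T x) = nm x.
  apply/le_anti; rewrite -[X in nm X <= nm (T _)]ST.
  by have := T1 x; have := S1 (T x); rewrite !mul1r => -> ->.
have Ti := isometry_inner Tn.
have Tvec I : T (vec X I) = vec Y I.
  by rewrite -(lincomb_delta (vec X)) Tj lincomb_delta.
have Tadj i x : T (adjoint (ops X i) x) = adjoint (ops Y i) (T x).
  have [A [a [AE Aa]]] := ops_adjoint X i.
  have [A' [a' [AE' Aa']]] := ops_adjoint Y i.
  have h1 z : nm ((T \o A) z) <= a * nm z.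
    by rewrite /= (le_trans (T1 _))// mul1r Aa.
  have h2 z : nm ((A' \o T) z) <= a' * nm z.
    by rewrite /= (le_trans (Aa' _))// Tn.
  rewrite AE AE'; apply: (dense_unique (@vec_dense X) h1 h2) => f /=.
  rewrite !raddf_lincomb; congr lincomb; apply/funext => I /=.
  by rewrite -[A _]/((A : _ -> _) _) -AE -vec_rcons !Tvec vec_rcons AE'.
exists T; split=> //; [by exists S|exact: (Tvec [::])|].
move=> i x; apply: inner_eq => z; rewrite -(TS z) Ti innerC ops_adjointP -innerC.
by rewrite [RHS]innerC ops_adjointP -[RHS]innerC -Tadj Ti.
Qed.

(** * Objects from kernels *)

Section Reconstruction.
Variables (C : seq 'I_d -> seq 'I_d -> R[i]) (hC : is_cuntz_kernel C).

Lemma cuntz_kernel_psd f : 0 <= kernel_form C f f.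
Proof. by case: hC => _ + _; apply; exact: fsuppP. Qed.

Lemma reconstruction : exists X : cuntz_object R d, object_kernel X = C.
Proof.
have [C1 _ Csum] := hC.
have [H [v [vC vd]]] := kolmogorov cuntz_kernel_psd.
have Tsum f g : \sum_i inner (lincomb (fun J => v (rcons J i)) f)
    (lincomb (fun J => v (rcons J i)) g) = inner (lincomb v f) (lincomb v g).
  under eq_bigr do rewrite lincomb_inner.
  rewrite kernel_form_sum lincomb_inner; apply: eq_kernel_form => I J.
  by under eq_bigr do rewrite vC; rewrite Csum vC.
have /choice[T hT] i : exists T : {linear H -> H},
    (forall f, T (lincomb v f) = lincomb (fun J => v (rcons J i)) f) /\
    forall x, nm (T x) <= 1 * nm x.
  apply: dense_extension => // f; rewrite mul1r.
  (* By [Tsum], the squared norm of the i-th image is one term of a nonnegative sum equal to the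
     squared norm of the original vector. *)
  rewrite -ler_sqr ?nnegrE ?nm_ge0// -lecR -!inner_nm -Tsum (bigD1 i)//= lerDl.
  by apply: sumr_ge0 => k _; rewrite innerxx exprn_ge0.
have Tv i I : T i (v I) = v (rcons I i).
  by rewrite -(lincomb_delta v) (hT i).1 lincomb_delta.
pose mV i := GRing.isLinear.Build R[i] H H _ (adjoint (T i))
  (adjoint_linear (linearP (T i)) (hT i).2).
pose V i : {linear H -> H} := HB.pack (adjoint (T i)) (mV i).
have VT i x y : inner (T i x) y = inner x (V i y).
  exact: adjointP (linearP (T i)) (hT i).2 x y.
have aV i : adjoint (V i) = T i.
  by apply: adjointE => x y; rewrite innerC -VT -innerC.
have unit : `|v [::]| = 1.
  by apply/eqP; rewrite -(@pexpr_eq1 _ _ 2)// -innerxx vC C1.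
have bdd i : bounded_near (V i) (nbhs (0 : H)).
  apply/bounded_nm; exists 1 => x.
  exact: adjoint_bound (linearP (T i)) (hT i).2 x.
have wv I : word_adjoint V I (v [::]) = v I.
  elim/last_ind: I => [//|I i IH].
  by rewrite /word_adjoint foldl_rcons -/(word_adjoint V I _) IH aV Tv.
have cyc : dense [set x : H | exists l : seq 'I_d -> R[i],
    finite_set [set I | l I != 0] /\
    x = \sum_(I \in [set: seq 'I_d]) l I *: word_adjoint V I (v [::])].
  apply/dense_nm => x e e0; have [n hn] := eps_small e0.
  have [f hf] := vd x n; exists (lincomb v f); last exact: le_lt_trans hf hn.
  exists f; split; first exact: fsuppP.
  by apply: eq_fsbigr => I _; rewrite wv.
have VTj f : \sum_i V i (T i (lincomb v f)) = lincomb v f.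
  apply: (inner_eq_dense vd) => g; rewrite inner_sumr -Tsum.
  by apply: eq_bigr => i _; rewrite -VT !(hT i).1.
(* [VTj] only covers the dense span. The sum of the [V i] after [T i] is symmetric, so in a pairing
   with a vector of that span it can be moved onto this vector. *)
have sum1 x : \sum_(i < d) V i (adjoint (V i) x) = x.
  apply: (inner_eq_dense vd) => f; rewrite -[in RHS]VTj inner_sumr.
  rewrite inner_suml.
  by apply: eq_bigr => i _; rewrite aV -VT innerC VT -innerC.
exists (CuntzObject unit bdd cyc sum1).
by apply/funext => I; apply/funext => J; rewrite /object_kernel /vec /= !wv vC.
Qed.

End Reconstruction.

End CuntzObjects.

(** * States are bounded *)

Section CStar.
Variables (R : realType) (A : cstarAlgType R).
Implicit Types x y z h : A.

Lemma cmulBl x y z : cmul (x - y) z = cmul x z - cmul y z.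
Proof. by rewrite cmulDl -[in cmul (- y) z]scaleN1r cmulZl scaleN1r. Qed.

Lemma cmulBr x y z : cmul x (y - z) = cmul x y - cmul x z.
Proof. by rewrite cmulDr -[in cmul x (- z)]scaleN1r cmulZr scaleN1r. Qed.

Lemma cmul0x x : cmul 0 x = 0.
Proof. by have := cmulBl x x x; rewrite !subrr. Qed.

Lemma cmulx0 x : cmul x 0 = 0.
Proof. by have := cmulBr x x x; rewrite !subrr. Qed.

Lemma starB x y : star (x - y) = star x - star y.
Proof. by rewrite starD -[in star (- y)]scaleN1r starZ rmorphN rmorph1 scaleN1r. Qed.

Lemma star0 : star (0 : A) = 0.
Proof. by have := starB 0 0; rewrite !subrr. Qed.

Lemma star1 : star (cone : A) = cone.
Proof. by rewrite -[LHS]cmul1x -{1}(starK cone) -starM cmul1x starK. Qed.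

Lemma nmM x y : nm (cmul x y) <= nm x * nm y.
Proof. by have := norm_cmul_le x y; rewrite !nmE -rmorphM lecR. Qed.

Lemma cstar_nm x : nm (cmul (star x) x) = nm x ^+ 2.
Proof. by apply: (@complexI R); rewrite -nmE cstar_norm nmE rmorphXn. Qed.

(** From |y|^2 = |y^* y| <= |y^*| |y|, applied to x and to its adjoint. *)
Lemma nm_star x : nm (star x) = nm x.
Proof.
suff h y : nm y <= nm (star y) by apply/le_anti; rewrite h -{2}(starK x) h.
have := nm_ge0 y; rewrite le_eqVlt => /predU1P[<-|y0]; first exact: nm_ge0.
by rewrite -(ler_pM2r y0) -expr2 -cstar_nm nmM.
Qed.

(* The square root of cone - h is cone - z for the fixed point z of the
   contraction z |-> (h + z^2) / 2, so no power series is needed. *)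
Lemma sqrt_one_minus h : star h = h -> nm h <= 2^-1 ->
  exists y, cone - h = cmul (star y) y.
Proof.
move=> hs h1.
(* The equation 2z = h + z^2 rearranges to (1 - z)^2 = 1 - h. The ball of radius 1/2 is mapped into
   itself, and there the Lipschitz constant is (|z| + |z'|)/2 <= 1/2. All iterates are self-adjoint,
   hence so is z. *)
pose phi z := (2^-1 : R)%:C *: (h + cmul z z).
have half0 : normc (2^-1 : R)%:C = 2^-1 by rewrite normc_real ger0_norm.
have phi_nm z : nm z <= 2^-1 -> nm (phi z) <= 2^-1.
  move=> z1; rewrite nmZ half0; have := nmD h (cmul z z); have := nmM z z.
  have := nm_ge0 z; nra.
have phi_lip z z' : nm z <= 2^-1 -> nm z' <= 2^-1 ->
    nm (phi z - phi z') <= 2^-1 * nm (z - z').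
  move=> z1 z1'; rewrite -scalerBr nmZ half0 ler_wpM2l//.
  rewrite opprD addrACA subrr add0r.
  have -> : cmul z z - cmul z' z' = cmul z (z - z') + cmul (z - z') z'.
    by rewrite cmulBr cmulBl addrA subrK.
  have := nmD (cmul z (z - z')) (cmul (z - z') z').
  have := nmM z (z - z'); have := nmM (z - z') z'; have := nm_ge0 (z - z'); nra.
pose u n := iter n phi 0.
have u1 n : nm (u n) <= 2^-1 by elim: n => [|n /phi_nm//]; rewrite nm0.
have us n : star (u n) = u n.
  elim: n => [|n IH]; first exact: star0.
  by rewrite /u iterS -/(u n) /phi starZ conj_real starD starM hs IH.
have uc n k : nm (u (n + k)%N - u n) <= 2^-1 ^+ n.
  elim: n => [|n IH].
    by rewrite add0n subr0 expr0; have := u1 k; lra.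
  by rewrite addSn exprS (le_trans (phi_lip _ _ _ _))// ler_wpM2l.
have [n m|z zP] := @fast_cvg R A u 1.
  rewrite mul1r; wlog nm : n m / (n <= m)%N => [hw|].
    have [/hw//|/ltnW/hw] := leqP n m.
    by move=> h2; rewrite nm_dist [leRHS]addrC.
  rewrite -(subnKC nm) nm_dist (le_trans (uc _ _))// (le_trans (eps_exp R n))//.
  by rewrite lerDl eps_ge0.
have z1 : nm z <= 2^-1.
  apply: (@le_eps _ _ _ 1) => n; have := nmB (u n) (u n - z); rewrite subKr.
  by have := zP n; have := u1 n; lra.
have zs : star z = z.
  apply: (@eq_nm_eps _ _ _ _ 2) => n; rewrite (le_trans (nm_tri (u n) _ _))//.
  by rewrite -{1}(us n) -starB nm_star nm_dist; have := zP n; lra.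
have zphi : phi z = z.
  apply: (@eq_nm_eps _ _ _ _ 2) => n; rewrite (le_trans (nm_tri (u n.+1) _ _))//.
  have := phi_lip z (u n) z1 (u1 n); rewrite (nm_dist z (u n)).
  have : eps R n.+1 <= eps R n by rewrite lef_pV2 ?posrE// ler_nat.
  have := zP n; have := zP n.+1; have := nm_ge0 (u n - z).
  rewrite -[u n.+1]/(phi (u n)); lra.
exists (cone - z); rewrite starB star1 zs cmulBl !cmulBr !cmul1x cmulx1.
have : h + cmul z z = z + z.
  have half2 : (2^-1 : R) + 2^-1 = 1 by lra.
  have -> : z + z = phi z + phi z by rewrite zphi.
  rewrite /phi -scalerDl -rmorphD half2.
  by rewrite rmorph1 scale1r.
move=> /(canRL (addrK _)) ->.
by rewrite !opprD !opprK !addrA.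
Qed.

Section States.
Variables (w : A -> R[i]) (hw : is_state w).

Lemma state_lin (a : R[i]) x y : w (a *: x + y) = a * w x + w y.
Proof. by case: hw => + _ _ => ->. Qed.

Lemma state0 : w 0 = 0.
Proof.
have := state_lin 1 0 0; rewrite scaler0 addr0 mul1r => /esym/eqP.
by rewrite -subr_eq0 addrK => /eqP.
Qed.

Lemma stateD x y : w (x + y) = w x + w y.
Proof. by have := state_lin 1 x y; rewrite scale1r mul1r. Qed.

Lemma stateZ (a : R[i]) x : w (a *: x) = a * w x.
Proof. by have := state_lin a x 0; rewrite state0 !addr0. Qed.

Lemma stateN x : w (- x) = - w x.
Proof. by rewrite -scaleN1r stateZ mulN1r. Qed.

Lemma state_form : psd_form (fun x y => w (cmul (star x) y)).
Proof.
split=> [x y z|a x y|x y z|a x y|x].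
- by rewrite starD cmulDl stateD.
- by rewrite starZ cmulZl stateZ.
- by rewrite cmulDr stateD.
- by rewrite cmulZr stateZ.
- by case: hw => _ + _; apply.
Qed.

(** If |y|^2 <= 1/2, then 1 - y^* y has the form z^* z, so w(y^* y) <= 1, and Cauchy-Schwarz against
    1 gives |w(y)| <= 1. Rescaling x to norm 1/2 produces the factor 2, which is not sharp but
    suffices for continuity. *)
Lemma state_bound x : normc (w x) <= 2 * nm x.
Proof.
have w1 : w cone = 1 by case: hw.
have hsq y : nm y ^+ 2 <= 2^-1 -> complex.Re (w (cmul (star y) y)) <= 1.
  move=> y1; have [||z hz] := @sqrt_one_minus (cmul (star y) y).
  - by rewrite starM starK.
  - by rewrite cstar_nm.
  have : 0 <= w (cone - cmul (star y) y).
    by rewrite hz; case: hw => _ + _; apply.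
  rewrite stateD stateN w1 lecE => /andP[_]; rewrite ReD ReN.
  have -> : complex.Re (1 : R[i]) = 1 by [].
  by have -> : complex.Re (0 : R[i]) = 0 by []; lra.
have hwy y : nm y ^+ 2 <= 2^-1 -> normc (w y) <= 1.
  move=> y1; have := form_CS state_form cone y; rewrite star1 cmul1x => h.
  rewrite (le_trans h)// /sn star1 cmul1x w1 -[leRHS]mul1r.
  rewrite ler_pM ?sqrtr_ge0//; first by rewrite sqrtr1.
  by rewrite -[leRHS]sqrtr1 ler_wsqrtr// hsq.
have := nm_ge0 x; rewrite le_eqVlt => /predU1P[x0|x0].
  have -> : x = 0 by apply: nm_eq0; rewrite -x0.
  by rewrite state0 normc0 nm0 mulr0.
pose t := (2 * nm x)^-1; have t0 : 0 < t by rewrite invr_gt0 mulr_gt0.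
have nt : normc t%:C = t by rewrite normc_real ger0_norm// ltW.
have : normc (w (t%:C *: x)) <= 1.
  apply: hwy; rewrite nmZ nt /t invfM mulfVK ?gt_eqF//.
  rewrite expr2 ler_piMr// ?invr_ge0// invf_le1//; lra.
rewrite stateZ normcM nt /t mulrC ler_pdivrMr ?mulr_gt0//.
by rewrite mul1r.
Qed.

End States.

Lemma state_eq_closed (w w' : A -> R[i]) : is_state w -> is_state w' ->
  closed [set x | w x = w' x].
Proof.
move=> hw hw'; apply/closed_nm => x hx.
apply: (@eq_normc_eps _ _ _ 4) => n; have [y /= yw xy] := hx _ (eps_gt0 R n).
have -> : w x - w' x = w (x - y) - w' (x - y).
  by rewrite !stateD ?stateN// yw opprD addrACA subrr addr0.
rewrite (le_trans (le_normcD _ _))// normcN.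
have := state_bound hw (x - y); have := state_bound hw' (x - y); lra.
Qed.

End CStar.

(** * Monomials span the Cuntz algebra *)

Section CuntzSpan.
Variables (R : realType) (A : cstarAlgType R).

Lemma lipschitz_closed (V W : normedModType R[i]) (f : V -> W) (c : R) (N : set W) :
  (forall x y, nm (f x - f y) <= c * nm (x - y)) -> closed N -> closed (f @^-1` N).
Proof.
move=> fc /closed_nm cN; apply/closed_nm => x hx /=; apply: cN => e e0.
have c1 : 0 < `|c| + 1 by rewrite ltr_wpDl.
have [|y Ny xy] := hx (e / (`|c| + 1)); first by rewrite divr_gt0.
exists (f y) => //; rewrite (le_lt_trans (fc _ _))//.
move: xy; rewrite ltr_pdivlMr//; have := nm_ge0 (x - y); have := ler_norm c; nra.
Qed.

Variables (d : nat) (s : 'I_d -> A).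

Definition subspace (N : set A) :=
  closed N /\ forall (a : R[i]) x y, N x -> N y -> N (a *: x + y).

Lemma word_prod0 : word_prod s [::] = cone.
Proof. by rewrite /word_prod big_nil. Qed.

Lemma word_prod_cons i I : word_prod s (i :: I) = cmul (s i) (word_prod s I).
Proof. by rewrite /word_prod big_cons. Qed.

Lemma word_prod_rcons I i : word_prod s (rcons I i) = cmul (word_prod s I) (s i).
Proof.
elim: I => [|j I IH]; first by rewrite word_prod_cons word_prod0 cmulx1 cmul1x.
by rewrite rcons_cons !word_prod_cons IH cmulA.
Qed.

Definition monomial I J := cmul (word_prod s I) (star (word_prod s J)).

Lemma subspace0 N x : subspace N -> N x -> N 0.
Proof. by case=> _ Nl Nx; rewrite -(addNr x) -scaleN1r; apply: Nl. Qed.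

Lemma subspace_mul N a : subspace N -> subspace [set x | N (cmul a x)].
Proof.
case=> cN Nl; split=> [|b x y /= Nx Ny].
  apply: (@lipschitz_closed _ _ (cmul a) (nm a)) cN => x y.
  by rewrite -cmulBr nmM.
by rewrite cmulDr cmulZr; apply: Nl.
Qed.

Hypothesis hA : is_cuntz_algebra s.

(* The closed span of the monomials is invariant under left multiplication by
   the generators and their adjoints, hence by the whole algebra. *)
Lemma cuntz_span N : subspace N -> (forall I J, N (monomial I J)) -> N = setT.
Proof.
move=> Nsub Nm; have [ss _] := cuntz_rel hA.
(* The closed span, as the intersection of all closed subspaces containing the monomials. *)
pose M := [set x | forall N', subspace N' -> (forall I J, N' (monomial I J)) -> N' x].
have M1 : M cone.
  by move=> N' _ /(_ [::] [::]); rewrite /monomial word_prod0 star1 cmulx1.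
have Msub : subspace M.
  split=> [|a x y Mx My N' Ns Nm']; last by apply: Ns.2; [apply: Mx|apply: My].
  apply/closed_nm => x hx N' Ns Nm'; move/closed_nm: (Ns.1); apply=> e e0.
  by have [y My xy] := hx e e0; exists y => //; apply: My.
have Minv a : (forall I J, M (cmul a (monomial I J))) -> forall x, M x -> M (cmul a x).
  move=> h x Mx N' Ns Nm'.
  by apply: (Mx _ (subspace_mul a Ns)) => I J; apply: h.
have Ms i x : M x -> M (cmul (s i) x).
  apply: Minv => I J N' _ /(_ (i :: I) J).
  by rewrite /monomial word_prod_cons cmulA.
have Mss i x : M x -> M (cmul (star (s i)) x).
  (* With an empty left word, s_i^* s_J^* is the adjoint of s_J s_i, so the right word grows at its
     end. Otherwise the first letter of the left word is cancelled or the product vanishes. *)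
  apply: Minv => -[|k I] J N' Ns Nm'.
    have := Nm' [::] (rcons J i); rewrite /monomial word_prod_rcons starM.
    by rewrite word_prod0 !cmul1x.
  rewrite /monomial word_prod_cons !cmulA ss; case: eqP => _.
    by rewrite cmul1x; apply: Nm'.
  by rewrite !cmul0x; apply: subspace0 Ns (Nm' [::] [::]).
(* Requiring invariance under x and under its adjoint makes the set closed under the involution.
   Once it is everything, x = x 1 lies in [M]. *)
pose S := [set x | forall y, M y -> M (cmul x y) /\ M (cmul (star x) y)].
have Salg : closed_star_subalgebra S.
  split=> [||a x y Sx Sy z Mz|x y Sx Sy z Mz|x Sx z Mz].
  - have -> : S = \bigcap_(y in M)
        ((cmul ^~ y) @^-1` M `&` ((fun x => cmul (star x) y) @^-1` M)).
      by apply/seteqP; split=> x /= h y My; [case: (h y My)|split; case: (h y My)].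
    apply: closed_bigI => y My; apply: closedI.
      apply: (@lipschitz_closed _ _ _ (nm y)) Msub.1 => u v.
      by rewrite -cmulBl mulrC nmM.
    apply: (@lipschitz_closed _ _ _ (nm y)) Msub.1 => u v.
    by rewrite -cmulBl -starB mulrC -(nm_star (u - v)) nmM.
  - by move=> y My; rewrite star1 cmul1x.
  - have [? ?] := Sx z Mz; have [? ?] := Sy z Mz.
    by rewrite starD starZ !cmulDl !cmulZl; split; apply: Msub.2.
  - by rewrite starM -!cmulA; split; [apply: (Sx _ _).1; apply: (Sy _ _).1|
      apply: (Sy _ _).2; apply: (Sx _ _).2].
  - by rewrite starK; have [] := Sx z Mz.
have ST : S = setT.
  by apply: cuntz_generated hA _ Salg _ => i y My; split; [apply: Ms|apply: Mss].
apply/seteqP; split=> // x _.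
have /(_ _ M1)[] : S x by rewrite ST.
by rewrite cmulx1 => /(_ _ Nsub Nm).
Qed.

Lemma state_inj (w w' : A -> R[i]) : is_state w -> is_state w' ->
  (forall I J, w (monomial I J) = w' (monomial I J)) -> w = w'.
Proof.
move=> hw hw' h; apply/funext => x.
have : [set x | w x = w' x] = setT.
  apply: cuntz_span => //; split=> [|a u v /= wu wv]; first exact: state_eq_closed.
  by rewrite !state_lin// wu wv.
by move=> /seteqP[_ /(_ x)]; apply.
Qed.

(** Positivity is that of the form w(x^* y) on combinations of the s_I^*; the summation rule comes
    from inserting the sum of the s_i s_i^* between s_I and s_J^*. *)
Lemma state_kernelP (w : A -> R[i]) : is_state w ->
  is_cuntz_kernel (fun I J => w (monomial I J)).
Proof.
move=> hw; split=> [|l hl|I J].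
- by rewrite /monomial word_prod0 star1 cmulx1; case: hw.
- have := form_lincomb (fun I => star (word_prod s I)) (fun I => star (word_prod s I))
    (fsupp_of hl) (fsupp_of hl) (state_form hw).
  under [X in _ = X -> _]eq_kernel_form do rewrite starK.
  by rewrite /kernel_form /= => <-; case: hw => _ + _; apply.
have [_ sum1] := cuntz_rel hA.
have -> : monomial I J = \sum_(i < d) monomial (rcons I i) (rcons J i).
  under eq_bigr do rewrite /monomial !word_prod_rcons starM -cmulA (cmulA (s _)).
  rewrite -(big_morph _ (cmulDr _) (cmulx0 _)).
  by rewrite -(big_morph (cmul ^~ _) (fun u v => cmulDl u v _) (cmul0x _)) sum1 cmul1x.
by rewrite (big_morph _ (stateD hw) (state0 hw)).
Qed.

End CuntzSpan.

(** * Dilation of a kernel to a Cuntz family *)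

Section OperatorsDense.
Variables (R : realType) (H : hilbertType R) (X : choiceType) (v : X -> H).
Hypothesis vd : dense_range (lincomb v).
Implicit Types f g : operators H.

Lemma op_lincomb f l : bop_fun f (lincomb v l) = lincomb (bop_fun f \o v) l.
Proof.
rewrite !(lincombE _ (@supp_notin _ _ l)).
by rewrite (big_morph _ (opD f) (op0 f)); apply: eq_bigr => x _; rewrite opZ.
Qed.

Lemma op_eq_dense f g : (forall x, bop_fun f (v x) = bop_fun g (v x)) -> f = g.
Proof.
move=> fg; apply: bop_eq => x; apply: (@eq_nm_eps _ _ _ _ (nm (f - g))) => n.
have [l hl] := vd x n.
have e : bop_fun (f - g) (lincomb v l) = 0.
  rewrite bopDE bopNE !op_lincomb; apply/eqP; rewrite subr_eq0; apply/eqP.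
  by congr lincomb; apply/funext => y /=.
have -> : bop_fun f x - bop_fun g x = bop_fun (f - g) (x - lincomb v l).
  by rewrite opD -scaleN1r opZ e scaler0 addr0 bopDE bopNE.
by rewrite (le_trans (op_nm _ _))// ler_wpM2l ?nm_ge0.
Qed.

Lemma inner_eq_dense_vec y z : (forall x, inner (v x) y = inner (v x) z) -> y = z.
Proof.
move=> h; apply: (inner_eq_dense vd) => f.
rewrite !(lincombE _ (@supp_notin _ _ f)).
rewrite !inner_suml.
by apply: eq_bigr => x _; rewrite !(formZl (inner_form H)) h.
Qed.

End OperatorsDense.

Section Dilation.
Variables (R : realType) (d : nat) (C : seq 'I_d -> seq 'I_d -> R[i]).
Hypothesis hC : is_cuntz_kernel C.

(* The kernel omega((s_I s_J^* )^* s_K s_L^* ) that a state omega with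
   omega(s_I s_J^* ) = C I J would have. *)
Fixpoint dkernel (I K J L : seq 'I_d) : R[i] :=
  match I, K with
  | i :: I', k :: K' => if i == k then dkernel I' K' J L else 0
  | [::], _ => C (J ++ K) L
  | _, [::] => C J (L ++ I)
  end.

Lemma dkernel0l K J L : dkernel [::] K J L = C (J ++ K) L.
Proof. by case: K. Qed.

Lemma dkernel0r I J L : dkernel I [::] J L = C J (L ++ I).
Proof. by case: I => [|//]; rewrite /= !cats0. Qed.

(** The sum over words of length n, by recursion on the first letter so as to run in parallel with
    [dkernel] and [component]. *)
Fixpoint word_sum (n : nat) (F : seq 'I_d -> R[i]) : R[i] :=
  if n is n'.+1 then \sum_(i < d) word_sum n' (fun Q => F (i :: Q)) else F [::].

Lemma word_sum_ge0 n F : (forall Q, 0 <= F Q) -> 0 <= word_sum n F.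
Proof. by elim: n F => [|n IH] F F0 //=; apply: sumr_ge0 => i _; apply: IH. Qed.

Lemma word_sum0 n : word_sum n (fun=> 0) = 0.
Proof. by elim: n => [//|n IH] /=; apply: big1 => i _. Qed.

Lemma eq_word_sum n F G : F =1 G -> word_sum n F = word_sum n G.
Proof. by move=> FG; congr word_sum; apply/funext. Qed.

Lemma kernel_form_word_sum (X : choiceType) (k : seq 'I_d -> X -> X -> R[i]) n f :
  word_sum n (fun Q => kernel_form (k Q) f f) =
  kernel_form (fun x y => word_sum n (fun Q => k Q x y)) f f.
Proof.
elim: n k => [//|n IH] k /=; rewrite -kernel_form_sum.
by apply: eq_bigr => i _; rewrite IH.
Qed.

Lemma word_sum_cuntz n J L : word_sum n (fun Q => C (J ++ Q) (L ++ Q)) = C J L.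
Proof.
elim: n J L => [|n IH] J L /=; first by rewrite !cats0.
case: hC => _ _ <-; apply: eq_bigr => i _; rewrite -IH.
by apply: eq_word_sum => Q; rewrite !cat_rcons.
Qed.

Section Vectors.
Variables (K : hilbertType R) (u : seq 'I_d -> K).
Hypothesis uC : forall I J, inner (u I) (u J) = C I J.

(* The component in s_Q K of s_I s_J^* Omega, for words Q at least as long as I. *)
Fixpoint component (I Q J : seq 'I_d) : K :=
  match I, Q with
  | [::], _ => u (J ++ Q)
  | i :: I', q :: Q' => if i == q then component I' Q' J else 0
  | _, [::] => 0
  end.

Lemma component0 Q J : component [::] Q J = u (J ++ Q).
Proof. by case: Q. Qed.

(** Expanding s_I s_J^* as the sum of s_{IP} s_{JP}^* over words P of length n - |I| gives left
    words Q = IP of length n, and the ranges of distinct s_Q are orthogonal. The inner product is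
    thus a sum over Q of inner products in [K]. *)
Lemma dkernel_component n I K' J L : (size I <= n)%N -> (size K' <= n)%N ->
  word_sum n (fun Q => inner (component I Q J) (component K' Q L)) = dkernel I K' J L.
Proof.
elim: n I K' J L => [|n IH] I K' J L.
  by case: I => //; case: K' => //= _ _; rewrite !cats0 uC.
case: I => [|i I]; case: K' => [|k K'] In Kn.
- rewrite dkernel0l cats0 -(word_sum_cuntz n.+1).
  by apply: eq_word_sum => Q; rewrite !component0 uC.
(* Only words Q beginning with k contribute; for these the empty left word on the other side passes
   k on to the end of J. *)
- rewrite dkernel0l -cat_rcons -dkernel0l -(IH [::])// /= (bigD1 k)//= big1 => [|i ik].
    by rewrite addr0; apply: eq_word_sum => Q; rewrite eqxx cat_rcons.
  rewrite -[RHS](word_sum0 n); apply: eq_word_sum => Q.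
  by rewrite eq_sym (negPf ik) inner0r.
- rewrite dkernel0r -cat_rcons -dkernel0r -(IH _ [::])// /= (bigD1 i)//= big1 => [|k ik].
    by rewrite addr0; apply: eq_word_sum => Q; rewrite eqxx cat_rcons.
  rewrite -[RHS](word_sum0 n); apply: eq_word_sum => Q.
  by rewrite eq_sym (negPf ik) inner0l.
rewrite /= (bigD1 i)//= big1 => [|q iq]; last first.
  rewrite -[RHS](word_sum0 n); apply: eq_word_sum => Q.
  by rewrite eq_sym (negPf iq) inner0l.
rewrite addr0 eqxx (eq_sym k); have [_|_] := eqVneq i k; first by rewrite -IH.
rewrite -[RHS](word_sum0 n); apply: eq_word_sum => Q.
by rewrite inner0r.
Qed.

End Vectors.

Definition pkernel (x y : seq 'I_d * seq 'I_d) := dkernel x.1 y.1 x.2 y.2.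

Lemma pkernel_psd f : 0 <= kernel_form pkernel f f.
Proof.
have [K [u [uC _]]] := kolmogorov (cuntz_kernel_psd hC).
(* The support of f is finite, so one length bounds all its left words; for that n the form is a sum
   of squared norms, one for each Q. *)
pose n := (\max_(x <- supp f) size x.1)%N.
pose k Q (x y : seq 'I_d * seq 'I_d) :=
  inner (component u x.1 Q x.2) (component u y.1 Q y.2).
have -> : kernel_form pkernel f f =
    kernel_form (fun x y => word_sum n (fun Q => k Q x y)) f f.
  rewrite !(kernel_formE _ (@supp_notin _ _ f) (@supp_notin _ _ f)).
  rewrite [LHS]big_seq [RHS]big_seq; apply: eq_bigr => x xf.
  rewrite [LHS]big_seq [RHS]big_seq; apply: eq_bigr => y yf.
  rewrite dkernel_component//; rewrite /n.
    exact: (@leq_bigmax_seq _ _ xpredT (fun x : seq 'I_d * seq 'I_d => size x.1) _ xf isT).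
  exact: (@leq_bigmax_seq _ _ xpredT (fun x : seq 'I_d * seq 'I_d => size x.1) _ yf isT).
rewrite -kernel_form_word_sum; apply: word_sum_ge0 => Q.
by rewrite -lincomb_inner innerxx exprn_ge0.
Qed.

Lemma dilation : exists (H : hilbertType R) (S : 'I_d -> operators H) (O : H),
  cuntz_relations S /\
  forall I J, inner O (bop_fun (monomial S I J) O) = C I J.
Proof.
have [H [v [vk vd]]] := kolmogorov pkernel_psd.
have /choice[T hT] i : exists T : {linear H -> H},
    (forall f, T (lincomb v f) = lincomb (fun x => v (i :: x.1, x.2)) f) /\
    forall x, nm (T x) <= 1 * nm x.
  (* A common first letter cancels in [dkernel], so the shift preserves all inner products. *)
  apply: dense_extension => // f; rewrite mul1r -!inner_sn /sn !lincomb_inner.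
  have -> // : (fun x y => inner (v (i :: x.1, x.2)) (v (i :: y.1, y.2))) =
    (fun x y => inner (v x) (v y)).
  by apply/funext => x; apply/funext => y; rewrite !vk /pkernel /= eqxx.
pose S i : operators H := op_of (linearP (T i)) (hT i).2.
have Sv i I J : bop_fun (S i) (v (I, J)) = v (i :: I, J).
  by rewrite -(lincomb_delta v) /= (hT i).1 lincomb_delta.
have SJv0 i J : bop_fun (star (S i)) (v ([::], J)) = v ([::], rcons J i).
  apply: (inner_eq_dense_vec vd) => -[K L]; rewrite -star_opP Sv !vk.
  by rewrite /pkernel /= dkernel0r -cats1 -catA.
have SJv i k I J : bop_fun (star (S i)) (v (k :: I, J)) = if i == k then v (I, J) else 0.
  apply: (inner_eq_dense_vec vd) => -[K L]; rewrite -star_opP Sv !vk.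
  by rewrite /pkernel /=; case: eqP => _; rewrite ?vk ?inner0r.
have Srel : cuntz_relations S.
  split=> [i j|]; apply: (op_eq_dense vd) => -[I J].
    by rewrite cmul_opE Sv SJv; case: eqP => _.
  (* On a nonempty left word only its first letter survives. On the empty one the identity is tested
     against all vectors, and the test against another empty left word is exactly the summation rule
     for C. *)
  rewrite sum_opE cone_opE; case: I => [|k I]; last first.
    under eq_bigr do rewrite cmul_opE SJv.
    rewrite (bigD1 k)//= [X in _ + X]big1 => [|i ik]; last first.
      by rewrite (negPf ik); exact: (op0 (S i)).
    by rewrite eqxx addr0; exact: (Sv k I J).
  apply: (inner_eq_dense_vec vd) => -[K L].
  rewrite inner_sumr vk.
  under eq_bigr do rewrite cmul_opE SJv0 Sv vk /pkernel/=.
  case: K => [|k K]; rewrite /pkernel /=.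
    by under eq_bigr do rewrite cats1; rewrite cats0; case: hC => _ _ ->.
  rewrite (bigD1 k)//= [X in _ + X]big1 => [|i ik]; last by rewrite eq_sym (negPf ik).
  by rewrite eqxx addr0 dkernel0r cat_rcons.
exists H, S, (v ([::], [::])); split=> // I J.
have SJw K : bop_fun (star (word_prod S K)) (v ([::], [::])) = v ([::], K).
  elim/last_ind: K => [|K i IH]; first by rewrite word_prod0 star1.
  by rewrite word_prod_rcons starM cmul_opE IH SJv0.
rewrite /monomial cmul_opE SJw -[word_prod S I]starK -star_opP SJw vk.
by rewrite /pkernel /= cats0.
Qed.

End Dilation.

(** * The two bijections *)

Lemma inj_surj_bijective (T U : Type) (f : T -> U) :
  injective f -> (forall y, exists x, f x = y) -> bijective f.
Proof.
move=> fi /choice[g fg]; exists g => // x; apply: fi; exact: fg.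
Qed.

Lemma sval_inj (T : Type) (P : T -> Prop) : injective (@sval T P).
Proof. by move=> [x Px] [y Py] /= xy; apply: eq_exist. Qed.

Theorem theorem2p1 (R : realType) (d : nat) (hd : (2 <= d)%N)
    (A : cstarAlgType R) (s : 'I_d -> A) (hA : is_cuntz_algebra s) :
  exists (F : state A -> cuntz_kernel R d)
         (G : unitary_class R d -> cuntz_kernel R d),
    [/\ bijective F, bijective G,
        forall (w : state A) (I J : seq 'I_d),
          sval w (cmul (word_prod s I) (star (word_prod s J))) = sval (F w) I J
      & forall (X : cuntz_object R d) (I J : seq 'I_d),
          sval (G (class_of X)) I J =
          inner (word_adjoint (ops X) I (vac X))
                (word_adjoint (ops X) J (vac X))].
Proof.
pose F (w : state A) : cuntz_kernel R d := exist _ _ (state_kernelP hA (svalP w)).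
(* A representative is chosen; [ker_rep] shows that its kernel is that of every member of the
   class. *)
pose rep (P : unitary_class R d) := projT1 (cid (svalP P)).
have repP P : sval P = unitary_equivalent (rep P) by exact: projT2 (cid (svalP P)).
pose G (P : unitary_class R d) : cuntz_kernel R d :=
  exist _ _ (object_kernelP (rep P)).
have ker_rep X : object_kernel (rep (class_of X)) = object_kernel X.
  apply/unitary_object_kernel; rewrite -repP /=.
  exact: object_kernel_unitary.
exists F, G; split=> [||w I J //|X I J].
- apply: inj_surj_bijective => [[w hw] [w' hw']|[C hC]].
    move=> /(congr1 sval) /= ww; apply: sval_inj => /=.
    by apply: (state_inj hA hw hw') => I J; have := congr1 (fun f => f I J) ww.
  have [H [S [O [Srel SC]]]] := dilation hC.
  have [f [f1 fM fJ fs]] := cuntz_universal hA Srel.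
  have fw I : f (word_prod s I) = word_prod S I.
    elim: I => [|i I IH]; first by rewrite !word_prod0.
    by rewrite !word_prod_cons fM fs IH.
  pose w x := inner O (bop_fun (f x) O).
  have wm I J : w (monomial s I J) = C I J.
    by rewrite /w /monomial fM fJ !fw SC.
  have hw : is_state w.
    split=> [a x y|x|].
    - by rewrite /w linearD linearZ /= innerDr innerZr.
    - by rewrite /w fM fJ cmul_opE -star_opP innerxx exprn_ge0.
    (* The unit is the monomial of two empty words, so normalization is C(empty, empty) = 1. *)
    have [C1 _ _] := hC; rewrite -[cone](cmul1x) -C1 -wm.
    by rewrite /monomial word_prod0 star1.
  exists (exist _ w hw); apply: sval_inj => /=.
  by apply/funext => I; apply/funext => J; rewrite wm.
- apply: inj_surj_bijective => [P Q /(congr1 sval) /= PQ|[C hC]].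
    (* Classes are predicates, so they agree once they have the same members, and membership depends
       only on the kernel. *)
    apply: sval_inj; rewrite !repP; apply/funext => X; apply/propext.
    by split=> /unitary_object_kernel h; apply: object_kernel_unitary; rewrite -h PQ.
  have [X XC] := reconstruction hC; exists (class_of X); apply: sval_inj => /=.
  by rewrite ker_rep.
- by have := congr1 (fun f => f I J) (ker_rep X).
Qed.
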